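(* Let $0 < s < 1$, let $C \subset \mathbb{R}$ be a closed $s$-regular set, and let $F \subset \mathbb{R}$ be a totally disconnected closed set. Then $C \times F \subset \mathbb{R}^2$ is $p$-removable for every $p > \frac{2-s}{1-s}$.
   Context: A set $C \subset \mathbb{R}$ is (Ahlfors) $s$-regular if there exists a constant $c_R > 0$ so that $$\frac{1}{c_R} r^s \le \mathcal{H}^s(B(x,r) \cap C) \le c_R r^s$$ for every $x \in C$ and $0 < r < \operatorname{diam}(C)$, where $\mathcal{H}^s$ is the $s$-dimensional Hausdorff measure and $B(x,r) = (x-r,x+r)$. For an open set $\Omega \subset \mathbb{R}^2$ and $1 \le p \le \infty$, $W^{1,p}(\Omega)$ consists of those $f \in L^p(\Omega)$ whose weak first order partial derivatives $\partial_i f$ are also in $L^p(\Omega)$. A closed set $E \subset \mathbb{R}^2$ is called $p$-removable (removable for $W^{1,p}$) if it has Lebesgue measure zero and $W^{1,p}(\mathbb{R}^2 \setminus E) = W^{1,p}(\mathbb{R}^2)$ as sets, i.e. every $u \in W^{1,p}(\mathbb{R}^2\setminus E)$, regarded as a function defined almost everywhere on $\mathbb{R}^2$, belongs to $W^{1,p}(\mathbb{R}^2)$. *)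

(* Defs.v *)
From HB Require Import structures.
From mathcomp Require Import all_boot all_order all_algebra.
From mathcomp Require Import all_classical all_reals all_analysis.

Set Implicit Arguments.
Unset Strict Implicit.
Unset Printing Implicit Defensive.

Import Order.TTheory GRing.Theory Num.Theory.
Import numFieldNormedType.Exports.

Local Open Scope classical_set_scope.
Local Open Scope ring_scope.

Section Hausdorff.
Context {R : realType}.
Implicit Types (A C : set R) (s delta : R).

(* The point 0 is added so that the empty set has diameter 0. *)
Definition diameter A : \bar R :=
  ereal_sup (0%E |` [set (`|z.1 - z.2|)%:E | z in A `*` A]).

(* Finite covers are the ones that are eventually empty: an empty set
   contributes 0 `^ s = 0, provided s != 0. *)
Definition hausdorff_pre s delta A : \bar R :=
  ereal_inf [set (\sum_(0 <= k <oo) (diameter (U k) `^ s)%E)%E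
            | U in [set U : nat -> set R | A `<=` \bigcup_k U k /\
                    forall k, (diameter (U k) <= delta%:E)%E]].

Definition hausdorff_measure s A : \bar R :=
  ereal_sup [set hausdorff_pre s delta A | delta in [set delta | 0 < delta]].

Definition ahlfors_regular s C : Prop :=
  exists2 c : R, 0 < c &
    forall x r : R, C x -> 0 < r -> (r%:E < diameter C)%E ->
      ((c^-1 * r `^ s)%:E <= hausdorff_measure s (ball x r `&` C)
                          <= (c * r `^ s)%:E)%E.

End Hausdorff.

Section Sobolev.
Context {R : realType}.
Implicit Types (Omega E : set (R * R)) (u v g phi : R * R -> R) (p : \bar R).

Definition lebesgue_measure2 :
    {measure set (measurableTypeR R * measurableTypeR R) -> \bar R} :=
  ((@lebesgue_measure R : {sigma_finite_measure set (measurableTypeR R) -> \bar R})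
   \x (@lebesgue_measure R : {sigma_finite_measure set (measurableTypeR R) -> \bar R}))%E.

Definition basis_vec (i : 'I_2) : R * R := if i == ord0 then (1, 0) else (0, 1).

Definition partial (i : 'I_2) phi : R * R -> R := 'D_(basis_vec i) phi.

Definition smooth phi : Prop :=
  forall l : seq 'I_2, let psi := foldr partial phi l in
    continuous psi /\ forall z i, derivable psi z (basis_vec i).

Definition test_function Omega phi : Prop :=
  let supp := closure [set z | phi z != 0] in
  [/\ smooth phi, compact supp & supp `<=` Omega].

Definition weak_partial Omega (i : 'I_2) u g : Prop :=
  forall phi, test_function Omega phi ->
    \int[lebesgue_measure2]_(z in Omega) (u z * partial i phi z) =
    - \int[lebesgue_measure2]_(z in Omega) (g z * phi z).

(* Elements of W^{1,p}(Omega) are classes modulo equality a.e. on Omega; they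
   are encoded as a.e.-saturated sets of functions on the whole plane, whose
   values outside Omega are irrelevant.  As measurability in the library is
   Borel measurability, u is required to have a Borel representative v, which
   is Lebesgue measurability of u on Omega. *)
Definition W1p Omega p : set (R * R -> R) :=
  [set u | exists v,
    [/\ {ae lebesgue_measure2, forall z, Omega z -> u z = v z},
        v \_ Omega \in Lfun lebesgue_measure2 p &
        forall i, exists2 g, g \_ Omega \in Lfun lebesgue_measure2 p
                           & weak_partial Omega i v g]].

Definition removable p E : Prop :=
  [/\ closed E, lebesgue_measure2 E = 0%E & W1p (~` E) p = W1p setT p].

End Sobolev.

(* Main.v *)
Require Import Defs.
From mathcomp Require Import all_boot all_order all_algebra.
From mathcomp Require Import all_classical all_reals all_analysis.
From mathcomp Require Import measurable_realfun ess_sup_inf.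
From mathcomp Require Import ring lra.
Import Order.TTheory GRing.Theory Num.Theory.
Import numFieldNormedType.Exports.
Local Open Scope classical_set_scope.
Local Open Scope ring_scope.

Set Implicit Arguments.
Unset Strict Implicit.
Unset Printing Implicit Defensive.

(* Let [u] be a Sobolev function off [E = C `*` F] with weak partial derivatives
   [g0], [g1].  Regularity gives smooth cutoffs [chi] in the first variable that
   vanish near [C], equal [1] off a set of measure [O(e^(1-s))] and satisfy
   [|chi'| = O(1/e)], with [e = 2^-n].

   Vertical derivative: test with [chi * phi]; as [d_1 (chi * phi) =
   chi * d_1 phi], the error is an integral over a set of vanishing measure.

   Horizontal derivative: for a test function [phi] put
   [L b = \int (u * d_0 phi + g0 * phi) * b(y)]; the claim is [L 1 = 0], and [L b = 0]
   as soon as [b] vanishes near [F].  For [Psi] bounded and supported in an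
   interval of length [O(e)], with [|Psi'| = O(1/e)], write
   [1 = chi + (1 - chi)] in [L Psi'].  Integrating the [chi] part by parts in [x],
   then in [y], turns it into [\int (u * d_1 phi + g1 * phi) * chi' * Psi].  All
   integrands then live on a set of measure [O(e^(2-s))], and Hölder's inequality
   gives [L Psi' = O(e^c)] with [c = (2 - s)(1 - 1/p) - 1], which is positive
   exactly when [p > (2 - s)/(1 - s)].  Hence the averages of [L] at scale [e]
   vary by [O(e^c)] under halving [e] or shifting by [e].  They vanish eventually
   at centres off the closed set [F], whose complement is dense, so all of them
   are [O(e^c)].  Summing over a partition of unity at scale [e] gives [L 1 = 0]. *)

(** * Smooth functions of one variable *)

Section smooth1.
Context {R : realType}.
Implicit Types (f g : R -> R) (n : nat) (x a b : R).

(** Derivatives are carried as witnesses, so that closure properties go by induction on [n];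
    continuity comes from differentiability. *)
Fixpoint nderivable1 n f : Prop :=
  if n is n'.+1 then
    exists2 f', (forall x, is_derive x 1 f (f' x)) & nderivable1 n' f'
  else True.

Definition smooth1 f := forall n, nderivable1 n f.

Lemma is_derive1_unique f f1 f2 : (forall x, is_derive x 1 f (f1 x)) ->
  (forall x, is_derive x 1 f (f2 x)) -> f1 = f2.
Proof.
move=> h1 h2; apply/funext => x.
by rewrite -(@derive_val _ _ _ _ _ _ _ (h1 x)) (@derive_val _ _ _ _ _ _ _ (h2 x)).
Qed.

Lemma is_derive1_continuous f f1 : (forall x, is_derive x 1 f (f1 x)) ->
  continuous f.
Proof.
by move=> h x; apply: differentiable_continuous; apply/derivable1_diffP; case: (h x).
Qed.

Lemma smooth1_cont f : smooth1 f -> continuous f.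
Proof. by move=> /(_ 1%N) [f' /is_derive1_continuous]. Qed.

Lemma smooth1_is_derive f : smooth1 f ->
  exists2 f', (forall x, is_derive x 1 f (f' x)) & smooth1 f'.
Proof.
move=> sf; have [f1 h1 _] := sf 1%N; exists f1 => // n.
by have [f2 h2] := sf n.+1; rewrite (is_derive1_unique h1 h2).
Qed.

Lemma smooth1_antiderivative f F : smooth1 f ->
  (forall x, is_derive x 1 F (f x)) -> smooth1 F.
Proof. by move=> sf hF [|n] //=; exists f. Qed.

Lemma smooth1_cst a : smooth1 (fun=> a).
Proof.
suff h b n : nderivable1 n (fun=> b) by move=> n; exact: h.
elim: n b => [|n IH] b //=; exists (fun=> 0) => // x; exact: is_derive_cst.
Qed.

Lemma nderivable1S n f : nderivable1 n.+1 f -> nderivable1 n f.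
Proof.
elim: n f => [|n IH] f // [f' h /IH Cf'].
by exists f'.
Qed.

Lemma nderivable1D n f g : nderivable1 n f -> nderivable1 n g -> nderivable1 n (fun x => f x + g x).
Proof.
elim: n f g => [|n IH] f g // [f' hf Cf] [g' hg Cg].
exists (fun x => f' x + g' x); last exact: IH.
move=> x; exact: is_deriveD.
Qed.

Lemma nderivable1M n f g : nderivable1 n f -> nderivable1 n g -> nderivable1 n (fun x => f x * g x).
Proof.
elim: n f g => [|n IH] f g // Cf Cg.
have [f' hf Cf'] := Cf; have [g' hg Cg'] := Cg.
exists (fun x => f x * g' x + g x * f' x).
  by move=> x; exact: is_deriveM.
by apply: nderivable1D; apply: IH => //; exact: nderivable1S.
Qed.

Lemma smooth1D f g : smooth1 f -> smooth1 g -> smooth1 (fun x => f x + g x).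
Proof. by move=> sf sg n; exact: nderivable1D. Qed.

Lemma smooth1M f g : smooth1 f -> smooth1 g -> smooth1 (fun x => f x * g x).
Proof. by move=> sf sg n; exact: nderivable1M. Qed.

Lemma smooth1B f g : smooth1 f -> smooth1 g -> smooth1 (fun x => f x - g x).
Proof.
move=> sf sg; apply: smooth1D => //.
have := smooth1M (smooth1_cst (-1)) sg.
by congr smooth1; apply/funext => x; rewrite mulN1r.
Qed.

Lemma smooth1_sum (I : Type) (r : seq I) (P : pred I) (F : I -> R -> R) :
  (forall i, smooth1 (F i)) -> smooth1 (fun x => \sum_(i <- r | P i) F i x).
Proof.
move=> sF; elim: r => [|i r IH].
  have := smooth1_cst 0; congr smooth1; apply/funext => x; rewrite big_nil//.
case: (boolP (P i)) => Pi.
  have := smooth1D (sF i) IH; congr smooth1; apply/funext => x.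
  by rewrite big_cons Pi.
move: IH; congr smooth1; apply/funext => x; by rewrite big_cons (negbTE Pi).
Qed.

Lemma is_derive1_affine f a b x d : is_derive (a * x + b) 1 f d ->
  is_derive x 1 (fun x => f (a * x + b)) (a * d).
Proof.
move=> h; have ha : is_derive x 1 (fun x : R => a * x + b) a.
  have hZ : is_derive x 1 (fun x : R => a * x) (a *: 1).
    exact: (@is_deriveZ _ _ _ (@id R) a x 1 1 (is_derive_id _ _)).
  have := @is_deriveD _ _ _ _ _ _ _ _ _ hZ (is_derive_cst b x 1).
  by rewrite addr0 /GRing.scale /= mulr1.
have := @is_derive1_comp _ f (fun x : R => a * x + b) x d a h ha.
by rewrite mulrC.
Qed.

Lemma smooth1_affine f a b : smooth1 f -> smooth1 (fun x => f (a * x + b)).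
Proof.
suff h n g : nderivable1 n g -> nderivable1 n (fun x => g (a * x + b)) by move=> sf n; exact: h.
elim: n g => [|n IH] g // [g' hg Cg].
exists (fun x => a * g' (a * x + b)); last first.
  by apply: nderivable1M; [exact: smooth1_cst | exact: IH].
by move=> x; exact: is_derive1_affine.
Qed.

End smooth1.

(** * Flat functions at the origin *)

Section bump.
Context {R : realType}.
Implicit Types (f g : R -> R) (n k : nat) (x a b : R).

(** The classical flat function is [flat 0]; the powers of [x^-1] make the span of the family closed
    under differentiation. *)
Definition flat k x : R := if x <= 0 then 0 else x^-1 ^+ k * expR (- x^-1).

Lemma flat_ge0 k x : 0 <= flat k x.
Proof.
rewrite /flat; case: (leP x 0) => // x0.
by rewrite mulr_ge0 ?expR_ge0// exprn_ge0 // invr_ge0 ltW.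
Qed.

(** [expR x] is the [k.+1]-th power of [expR (x / k.+1%:R)]: [k] of the factors dominate
    [x / k.+1%:R], and the last is at least [1]. *)
Lemma powXexpRN_le k x : 0 < x -> x ^+ k * expR (- x) <= k.+1%:R ^+ k.
Proof.
move=> x0; rewrite expRN ler_pdivrMr ?expR_gt0//.
have -> : expR x = expR (x / k.+1%:R) ^+ k.+1.
  by rewrite -expRM_natl -[k.+1%:R * _]mulrC divfK.
have h : x / k.+1%:R <= expR (x / k.+1%:R).
  by apply: le_trans (expR_ge1Dx _); rewrite lerDr.
have hk : 0 < k.+1%:R :> R by rewrite ltr0n.
rewrite {1}(_ : x = k.+1%:R * (x / k.+1%:R)); last by rewrite mulrC divfK.
rewrite exprMn ler_pM2l ?exprn_gt0// exprS.
have e1 : 1 <= expR (x / k.+1%:R) by rewrite -expR0 ler_expR divr_ge0// ltW.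
apply: le_trans (_ : expR (x / k.+1%:R) ^+ k <= _).
  by rewrite lerXn2r// nnegrE ?divr_ge0 ?expR_ge0 // ltW.
by rewrite ler_peMl// exprn_ge0// expR_ge0.
Qed.

Lemma flat_le k x : 0 <= x -> flat k x <= k.+2%:R ^+ k.+1 * x.
Proof.
rewrite /flat; case: (leP x 0) => [x0 x0'|x0 _]; first by rewrite mulr_ge0.
have := @powXexpRN_le k.+1 x^-1; rewrite invr_gt0 => /(_ x0).
rewrite exprS -mulrA mulrC => h; rewrite -ler_pdivrMr//.
Qed.

Lemma is_derive_flat k x :
  is_derive x 1 (flat k) (flat k.+2 x - k%:R * flat k.+1 x).
Proof.
have [x0|x0|x0] := ltgtP x 0.
- apply: (@near_eq_is_derive _ _ _ (cst 0)).
    near=> y; rewrite /= /flat ifT//; apply/ltW; near: y; exact: lt_nbhsl.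
  rewrite /flat ltW// mulr0 subr0; exact: is_derive_cst.
- pose g (y : R) : R := y^-1 ^+ k * expR (- y^-1).
  have hg : \forall y \near x, g y = flat k y.
    near=> y; rewrite /g /= /flat ifF//; apply/negbTE; rewrite -ltNge.
    near: y; exact: lt_nbhsr.
  have hV : is_derive x 1 (fun y : R => y^-1) (- x ^- 2).
    have := @is_deriveV R id x 1 1 (lt0r_neq0 x0) (is_derive_id _ _).
    by rewrite /GRing.scale /= mulr1.
  have hX := @is_deriveX _ _ _ k _ _ _ hV; rewrite exprfctE in hX.
  have hN := @is_deriveN _ _ _ _ _ _ _ hV.
  have hE := @is_derive1_comp _ expR _ _ _ _ (is_derive_expR _) hN.
  apply: (near_eq_is_derive hg).
  have hM := @is_deriveM _ _ _ _ _ _ _ _ hX hE.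
  apply: (is_derive_eq hM); rewrite /flat leNgt x0 /=.
  rewrite /GRing.scale /= !opprK -!exprVn; set t := x^-1.
  change ((- [eta GRing.inv]) x) with (- t).
  case: k {g hg hX hM} => [|k] /=; first by ring.
  by rewrite !exprS expr0 mulr1; ring.
- have flat0 j : flat j 0 = 0 by rewrite /flat lexx.
  rewrite x0 !flat0 mulr0 subr0.
  (* For [h > 0] the difference quotient at [0] is [flat k.+1 h], which [flat_le] bounds by a
     multiple of [h]; for [h < 0] it is [0]. *)
  have hc : (h^-1 *: (flat k (h *: 1 + 0) - flat k 0)) @[h --> 0^'] --> (0 : R).
    apply/cvgr0Pnorm_lt => e e0.
    have K0 : 0 < k.+3%:R ^+ k.+2 :> R by rewrite exprn_gt0.
    near=> h; apply: (@le_lt_trans _ _ (k.+3%:R ^+ k.+2 * `|h|)); last first.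
      rewrite -ltr_pdivlMl//; near: h; apply: dnbhs0_lt.
      by rewrite mulr_gt0 ?invr_gt0.
    rewrite addr0 flat0 subr0 /GRing.scale /= mulr1 normrM normfV.
    have [h0|h0] := leP h 0.
      by rewrite /flat h0 normr0 mulr0 mulr_ge0.
    rewrite (gtr0_norm h0) (ger0_norm (flat_ge0 _ _)).
    have := @flat_le k.+1 h (ltW h0); apply: le_trans.
    by rewrite /flat (leNgt h) h0 /= exprS mulrA.
  split; last exact: cvg_lim hc.
  by apply/cvg_ex; exists 0.
Unshelve. all: by end_near. Qed.

Lemma smooth1_flat k : smooth1 (flat k).
Proof.
move=> n; elim: n k => [|n IH] k //=.
exists (fun x => flat k.+2 x - k%:R * flat k.+1 x); first exact: is_derive_flat.
have -> : (fun x => flat k.+2 x - k%:R * flat k.+1 x) =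
          (fun x => flat k.+2 x + (- k%:R) * flat k.+1 x).
  by apply/funext => x; rewrite mulNr.
by apply: nderivable1D => //; apply: nderivable1M => //; exact: smooth1_cst.
Qed.

End bump.

(** * Smooth step, kernel and antiderivatives *)

Section kernel.
Context {R : realType}.
Implicit Types (f g F : R -> R) (n k : nat) (x a b : R).

Lemma is_derive1_MVT f F a b : (forall x, is_derive x 1 F (f x)) -> a < b ->
  exists2 c, a < c < b & F b - F a = f c * (b - a).
Proof.
move=> h ab; have [|c] := MVT ab (fun x _ => h x).
  by apply: continuous_subspaceT; exact: is_derive1_continuous h.
by rewrite in_itv /= => ? ?; exists c.
Qed.

Lemma exists_antiderivative f a : continuous f -> (forall x, x <= a -> f x = 0) ->
  exists2 F, (forall x, is_derive x 1 F (f x)) & forall x, x <= a -> F x = 0.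
Proof.
move=> cf f0.
(* Starting at [a - 1] keeps every [x >= a] away from the lower endpoint, so that the fundamental
   theorem applies at [a] as well. *)
pose F x := \int[lebesgue_measure]_(t in [set` `[a - 1, x]]) f t.
have F0 x : x <= a -> F x = 0.
  move=> xa; rewrite /F (@eq_Rintegral _ _ _ _ _ (cst 0)).
    by rewrite Rintegral_cst// mul0r.
  move=> t; rewrite inE /= in_itv /= => /andP[_ tx].
  by rewrite f0// (le_trans tx).
exists F => // x; have [xa|ax] := ltP x a.
  rewrite (f0 _ (ltW xa)).
  have hF : \forall y \near x, cst 0 y = F y.
    by near=> y; rewrite /= F0//; apply/ltW; near: y; exact: lt_nbhsl.
  exact: (near_eq_is_derive hF (is_derive_cst _ _ _)).
have x1 : a - 1 < x by apply: lt_le_trans ax; rewrite ltrBlDr ltrDl.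
have xx : x < x + 1 by rewrite ltrDl.
have [|dF F'] := @continuous_FTC1_closed _ f (a - 1) x (x + 1) xx _ x1 (cf x).
  apply: continuous_compact_integrable; first exact: segment_compact.
  exact: continuous_subspaceT.
by split; [exact: dF|rewrite -derive1E].
Unshelve. all: by end_near. Qed.

Lemma bounded_of_const_tails f a b : continuous f ->
  (forall x, x < -1 -> f x = a) -> (forall x, 1 < x -> f x = b) ->
  exists2 B, 0 <= B & forall x, `|f x| <= B.
Proof.
move=> cf fa fb.
have cn : {within `[-1, 1], continuous (fun x => `|f x|)}.
  by apply: continuous_subspaceT => x; apply: continuous_comp (cf x) _; exact: norm_continuous.
have n11 : (-1 : R) <= 1 by lra.
have [c _ hc] := EVT_max n11 cn.
exists (`|f c| + `|a| + `|b|); first by rewrite !addr_ge0.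
move=> x; have [x1|x1] := ltP x (-1).
  by rewrite fa// -addrA addrCA lerDl addr_ge0.
have [x2|x2] := ltP 1 x; first by rewrite fb// lerDr addr_ge0.
by rewrite -addrA (le_trans (hc x _)) ?in_itv/= ?x1// lerDl addr_ge0.
Qed.

(** Normalise an antiderivative of [flat 0 x * flat 0 (1 - x)], which is positive exactly on []0,
    1[]. *)
Lemma exists_smooth_step : exists sigma : R -> R,
  [/\ smooth1 sigma, forall x, x <= 0 -> sigma x = 0 &
      forall x, 1 <= x -> sigma x = 1].
Proof.
pose k x : R := flat 0 x * flat 0 (1 - x).
have sk : smooth1 k.
  apply: smooth1M; first exact: smooth1_flat.
  have := @smooth1_affine _ _ (-1) 1 (@smooth1_flat R 0).
  by congr smooth1; apply/funext => x; rewrite mulN1r addrC.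
have k0 x : x <= 0 -> k x = 0 by move=> x0; rewrite /k /flat x0 mul0r.
have k1 x : 1 <= x -> k x = 0.
  by move=> x1; rewrite /k [X in _ * X]/flat subr_le0 x1 mulr0.
have [F hF F0] := exists_antiderivative (smooth1_cont sk) k0.
have F1 : 0 < F 1.
  have [c /andP[c0 c1]] := is_derive1_MVT hF (ltr01 : 0 < 1).
  rewrite (F0 _ (lexx _)) !subr0 mulr1 => ->.
  rewrite /k /flat !leNgt c0 subr_gt0 c1 /= !expr0 !mul1r.
  by rewrite mulr_gt0 ?expR_gt0.
have Fc x : 1 <= x -> F x = F 1.
  rewrite le_eqVlt => /predU1P[->//|x1].
  have [c /andP[c1 _]] := is_derive1_MVT hF x1.
  by rewrite k1 ?mul0r; [move/eqP; rewrite subr_eq0 => /eqP | exact: ltW].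
exists (fun x => (F 1)^-1 * F x); split.
- apply: smooth1M; first exact: smooth1_cst.
  exact: smooth1_antiderivative hF.
- by move=> x /F0 ->; rewrite mulr0.
- by move=> x /Fc ->; rewrite mulVf// gt_eqF.
Qed.

(* [beta] generates a smooth partition of unity by its integer translates, and
   [tau] is its antiderivative; the total mass [kappa] plays no role. *)
Lemma exists_kernel : exists (sigma beta beta' tau : R -> R) (kappa B : R),
  [/\ [/\ smooth1 beta, smooth1 beta' & smooth1 tau],
      [/\ forall x, is_derive x 1 beta (beta' x) & forall x, is_derive x 1 tau (beta x)],
      [/\ forall x, beta x = sigma (x + 1) - sigma x,
          forall x, x <= 0 -> sigma x = 0 & forall x, 1 <= x -> sigma x = 1],
      [/\ forall x, 1 <= `|x| -> beta x = 0, forall x, 1 < `|x| -> beta' x = 0,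
          forall x, x <= -1 -> tau x = 0 & forall x, 1 <= x -> tau x = kappa] &
      0 <= B /\ forall x, [/\ `|beta x| <= B, `|beta' x| <= B & `|tau x| <= B]].
Proof.
have [sigma [ss s0 s1]] := exists_smooth_step.
(* As a difference of translates of the step, [beta] has integer translates whose sums telescope. *)
pose beta x := sigma (x + 1) - sigma x.
have sb : smooth1 beta.
  apply: smooth1B => //; have := @smooth1_affine _ _ 1 1 ss.
  by congr smooth1; apply/funext => x; rewrite mul1r.
have b0 x : 1 <= `|x| -> beta x = 0.
  rewrite /beta ler_normr => /orP[x1|x1].
    by rewrite !s1 ?subrr//; lra.
  by rewrite !s0 ?subrr//; lra.
have bl x : x <= -1 -> beta x = 0.
  by move=> x1; apply: b0; rewrite ler_normr; apply/orP; right; lra.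
have br x : 1 <= x -> beta x = 0.
  by move=> x1; apply: b0; rewrite ler_normr x1.
have [tau ht t0] := exists_antiderivative (smooth1_cont sb) bl.
have [beta' hb sb'] := smooth1_is_derive sb.
have b'0 x : 1 < `|x| -> beta' x = 0.
  move=> x1.
  have hnear : \forall y \near x, cst 0 y = beta y.
    near=> y; rewrite /= b0// ltW//; near: y.
    exact: (cvgr_gt _ (@norm_continuous _ _ x) _ x1).
  have h1 : is_derive x 1 beta 0 := near_eq_is_derive hnear (is_derive_cst _ _ _).
  by rewrite -(@derive_val _ _ _ _ _ _ _ (hb x)) (@derive_val _ _ _ _ _ _ _ h1).
have tc x : 1 <= x -> tau x = tau 1.
  rewrite le_eqVlt => /predU1P[->//|x1].
  have [c /andP[c1 _]] := is_derive1_MVT ht x1.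
  by rewrite br ?mul0r; [move/eqP; rewrite subr_eq0 => /eqP | exact: ltW].
have st : smooth1 tau := smooth1_antiderivative sb ht.
have [B1 B10 hB1] := bounded_of_const_tails (smooth1_cont sb)
  (fun x h => bl x (ltW h)) (fun x h => br x (ltW h)).
have [B2 B20 hB2] : exists2 B, 0 <= B & forall x, `|beta' x| <= B.
  apply: (@bounded_of_const_tails _ 0 0); first exact: smooth1_cont.
    by move=> x x1; apply: b'0; rewrite ltr_normr; apply/orP; right; lra.
  by move=> x x1; apply: b'0; rewrite ltr_normr x1.
have [B3 B30 hB3] := bounded_of_const_tails (smooth1_cont st)
  (fun x h => t0 x (ltW h)) (fun x h => tc x (ltW h)).
exists sigma, beta, beta', tau, (tau 1), (B1 + B2 + B3); split => //.
split; first by rewrite !addr_ge0.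
move=> x; have := hB1 x; have := hB2 x; have := hB3 x => ? ? ?.
by split; lra.
Unshelve. all: by end_near. Qed.

(** At most three integers lie within distance [1] of [z]. *)
Lemma sum_norm_translates_le f (B : R) : 0 <= B -> (forall x, `|f x| <= B) ->
  (forall x, 1 < `|x| -> f x = 0) ->
  forall n z, \sum_(j < n) `|f (z - j%:R)| <= 3 * B.
Proof.
move=> B0 fB f0; elim=> [|n IH] z; first by rewrite big_ord0 mulr_ge0.
have [zn|zn] := ltP 1 `|z - n%:R|.
  by rewrite big_ord_recr /= (f0 _ zn) normr0 addr0.
(* Once index [n] is within [1] of [z], only [n], [n - 1] and [n - 2] can contribute. *)
have far m : (m.+2 <= n)%N -> \sum_(j < m) `|f (z - j%:R)| = 0.
  move=> mn; rewrite big1// => j _; rewrite f0 ?normr0//.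
  move: zn; rewrite ler_norml => /andP[zn _].
  have : (j.+3%:R : R) <= n%:R by rewrite ler_nat (leq_trans _ mn)// !ltnS.
  by rewrite -!natr1 ltr_normr => h; apply/orP; left; lra.
case: n IH zn far => [|[|n]] IH zn far; rewrite !big_ord_recr ?big_ord0/=.
- have := fB (z - 0); lra.
- have := fB (z - 0); have := fB (z - 1); lra.
- rewrite far// add0r; have := fB (z - n%:R); have := fB (z - n.+1%:R).
  have := fB (z - n.+2%:R); lra.
Qed.

End kernel.

(** * Smooth functions on the plane *)

Section smooth2.
Context {R : realType}.
Implicit Types (f g phi : R * R -> R) (a b : R -> R) (z : R * R) (i : 'I_2).

(** Continuity is demanded at every level, since the existence of both partial derivatives does not
    imply it. *)
Fixpoint nderivable2 n f : Prop :=
  if n is n'.+1 then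
    continuous f /\ forall i, exists2 f',
      (forall z, is_derive z (basis_vec i) f (f' z)) & nderivable2 n' f'
  else True.

Lemma partial_is_derive i f f' :
  (forall z, is_derive z (basis_vec i) f (f' z)) -> partial i f = f'.
Proof. by move=> h; apply/funext => z; have [_] := h z. Qed.

Lemma smooth_is_derive f i z : smooth f ->
  is_derive z (basis_vec i) f (partial i f z).
Proof. by move=> /(_ [::]) [_ h]; split => //; exact: h. Qed.

Lemma smooth_continuous f : smooth f -> continuous f.
Proof. by move=> /(_ [::]) []. Qed.

Lemma smooth_partial f i : smooth f -> smooth (partial i f).
Proof. by move=> sf l; have := sf (rcons l i); rewrite -cats1 foldr_cat. Qed.

(** Trades iterated [partial] for witnesses, on which closure under sums and products is a plain
    induction. *)
Lemma smoothP f : smooth f <-> forall n, nderivable2 n f.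
Proof.
split=> [sf n|].
  elim: n f sf => [//|n IH] f sf /=; split; first exact: smooth_continuous.
  move=> i; exists (partial i f); first by move=> z; exact: smooth_is_derive.
  exact/IH/smooth_partial.
move=> Cf l; have {Cf}: forall n, nderivable2 n (foldr partial f l).
  elim: l => [//|i l IH] n /=.
  have [_ /(_ i) [g' hg Cg]] := IH n.+1.
  by rewrite (partial_is_derive hg).
move=> /(_ 1%N) /= [cf h]; split => // z i.
by have [g' hg _] := h i; case: (hg z).
Qed.

Lemma nderivable2S n f : nderivable2 n.+1 f -> nderivable2 n f.
Proof.
elim: n f => [|n IH] f // [cf h]; split => // i.
by have [f' hf /IH Cf] := h i; exists f'.
Qed.

Lemma nderivable2D n f g : nderivable2 n f -> nderivable2 n g -> nderivable2 n (fun z => f z + g z).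
Proof.
elim: n f g => [|n IH] f g // [cf hf] [cg hg]; split.
  by move=> z; apply: cvgD; [exact: cf|exact: cg].
move=> i; have [f' df Cf] := hf i; have [g' dg Cg] := hg i.
exists (fun z => f' z + g' z); last exact: IH.
by move=> z; exact: is_deriveD.
Qed.

Lemma nderivable2M n f g : nderivable2 n f -> nderivable2 n g -> nderivable2 n (fun z => f z * g z).
Proof.
elim: n f g => [|n IH] f g // Cf Cg.
have [cf hf] := Cf; have [cg hg] := Cg; split.
  by move=> z; apply: cvgM; [exact: cf|exact: cg].
move=> i; have [f' df Cf'] := hf i; have [g' dg Cg'] := hg i.
exists (fun z => f z * g' z + g z * f' z).
  by move=> z; exact: is_deriveM.
by apply: nderivable2D; apply: IH => //; exact: nderivable2S.
Qed.

Lemma smoothM f g : smooth f -> smooth g -> smooth (fun z => f z * g z).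
Proof. by move=> /smoothP sf /smoothP sg; apply/smoothP => n; exact: nderivable2M. Qed.

(** Serves functions of one coordinate differentiated along the other axis, where the direction
    projects to [0]. *)
Lemma is_derive_vec0 a (x : R) : is_derive x 0 a 0.
Proof.
have e0 : (fun h : R => h^-1 *: (a (h *: (0 : R) + x) - a x)) = cst 0.
  by apply/funext => h; rewrite /GRing.scale /= mulr0 add0r subrr mulr0.
have hc : (h^-1 *: (a (h *: 0 + x) - a x)) @[h --> 0^'] --> (0 : R).
  by rewrite e0; exact: cvg_cst.
by split; [apply/cvg_ex; exists 0|exact: cvg_lim hc].
Qed.

Lemma is_derive_fst a z d e i : is_derive z.1 (basis_vec i).1 a d -> 
  (e = d) -> is_derive z (basis_vec i) (fun z => a z.1) e.
Proof. by move=> [h <-] ->; split. Qed.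

Lemma is_derive_snd a z d e i : is_derive z.2 (basis_vec i).2 a d -> 
  (e = d) -> is_derive z (basis_vec i) (fun z => a z.2) e.
Proof. by move=> [h <-] ->; split. Qed.

Lemma nderivable2_cst n (c : R) : nderivable2 n (fun=> c).
Proof.
elim: n c => [//|n IH] c; split; first by move=> z; exact: cvg_cst.
by move=> i; exists (fun=> 0) => // z; exact: is_derive_cst.
Qed.

Lemma smooth_fst a : smooth1 a -> smooth (fun z => a z.1).
Proof.
move=> sa; apply/smoothP => n; elim: n a sa => [//|n IH] a sa.
split; first by move=> z; apply: continuous_comp; [exact: cvg_fst|exact: smooth1_cont].
have [a' ha sa'] := smooth1_is_derive sa; move=> i.
exists (fun z => if i == ord0 then a' z.1 else 0).
  move=> z; apply: is_derive_fst (erefl _).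
  by rewrite /basis_vec; case: (i == ord0) => /=; [exact: ha|exact: is_derive_vec0].
by case: (i == ord0); [exact: IH|exact: nderivable2_cst].
Qed.

Lemma smooth_snd a : smooth1 a -> smooth (fun z => a z.2).
Proof.
move=> sa; apply/smoothP => n; elim: n a sa => [//|n IH] a sa.
split; first by move=> z; apply: continuous_comp; [exact: cvg_snd|exact: smooth1_cont].
have [a' ha sa'] := smooth1_is_derive sa; move=> i.
exists (fun z => if i == ord0 then 0 else a' z.2).
  move=> z; apply: is_derive_snd (erefl _).
  by rewrite /basis_vec; case: (i == ord0) => /=; [exact: is_derive_vec0|exact: ha].
by case: (i == ord0); [exact: nderivable2_cst|exact: IH].
Qed.

Lemma partial0_tensor phi a a' b : smooth phi ->
  (forall x : R, is_derive x 1 a (a' x)) -> smooth1 b ->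
  partial ord0 (fun z => phi z * (a z.1 * b z.2)) =
  (fun z => partial ord0 phi z * (a z.1 * b z.2) + phi z * (a' z.1 * b z.2)).
Proof.
move=> sphi ha sb; apply: partial_is_derive => z.
have ha1 : is_derive z (basis_vec ord0) (fun z => a z.1) (a' z.1).
  by apply: is_derive_fst (erefl _); exact: ha.
have hb1 : is_derive z (basis_vec ord0) (fun z => b z.2) 0.
  by apply: is_derive_snd (erefl _); exact: is_derive_vec0.
have hM := is_deriveM (smooth_is_derive ord0 z sphi) (is_deriveM ha1 hb1).
by apply: (is_derive_eq hM); rewrite /GRing.scale /= ?mulrfctE /=; ring.
Qed.

Lemma partial1_tensor phi a b b' : smooth phi -> smooth1 a ->
  (forall x : R, is_derive x 1 b (b' x)) ->
  partial ord_max (fun z => phi z * (a z.1 * b z.2)) =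
  (fun z => partial ord_max phi z * (a z.1 * b z.2) + phi z * (a z.1 * b' z.2)).
Proof.
move=> sphi sa hb; apply: partial_is_derive => z.
have ha1 : is_derive z (basis_vec ord_max) (fun z => a z.1) 0.
  by apply: is_derive_fst (erefl _); exact: is_derive_vec0.
have hb1 : is_derive z (basis_vec ord_max) (fun z => b z.2) (b' z.2).
  by apply: is_derive_snd (erefl _); exact: hb.
have hM := is_deriveM (smooth_is_derive ord_max z sphi) (is_deriveM ha1 hb1).
by apply: (is_derive_eq hM); rewrite /GRing.scale /= ?mulrfctE /=; ring.
Qed.

Lemma smooth_tensor phi a b : smooth phi -> smooth1 a -> smooth1 b ->
  smooth (fun z => phi z * (a z.1 * b z.2)).
Proof.
move=> sphi sa sb; apply: (@smoothM phi (fun z => a z.1 * b z.2)) => //.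
by apply: smoothM; [exact: smooth_fst|exact: smooth_snd].
Qed.

End smooth2.

(** * Test functions on the plane *)

Section test_functions.
Context {R : realType}.
Implicit Types (f g phi : R * R -> R) (a b : R -> R) (z : R * R) (i : 'I_2).

(** Vanishing near each point outside [Omega], and not just at it, keeps the closed support inside
    [Omega]; compactness is inherited from [phi]. *)
Lemma test_function_tensor (Omega : set (R * R)) phi a b :
  test_function setT phi -> smooth1 a -> smooth1 b ->
  (forall z, ~ Omega z -> \forall y \near z, phi y * (a y.1 * b y.2) = 0) ->
  test_function Omega (fun z => phi z * (a z.1 * b z.2)).
Proof.
move=> [sphi cphi _] sa sb h; split.
- exact: smooth_tensor.
- apply: subclosed_compact cphi _; first exact: closed_closure.
  apply: closureS => z /=; apply: contraNN => /eqP ->; by rewrite mul0r.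
- move=> z; apply: contraPP => /h hz /(_ _ hz) [y [/= /eqP]]; exact.
Qed.

Lemma test_function_window phi : test_function setT phi ->
  exists M : nat, forall z, phi z != 0 -> `|z.1| < M%:R /\ `|z.2| < M%:R.
Proof.
move=> [_ /compact_bounded [M [Mr hM]] _].
have M1 : M < `|M| + 1 by rewrite (le_lt_trans (ler_norm _))// ltrDl.
exists (Num.bound (`|M| + 1)) => z z0.
have := hM _ M1 z (@subset_closure _ [set z | phi z != 0] z z0).
rewrite /= prod_normE /= ge_max => /andP[h1 h2].
have := archi_boundP (addr_ge0 (normr_ge0 M) ler01) => hb.
by split; [exact: le_lt_trans h1 hb|exact: le_lt_trans h2 hb].
Qed.

Lemma partial_eq0 phi i z : (\forall y \near z, phi y = 0) -> partial i phi z = 0.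
Proof.
move=> h.
have hn : \forall y \near z, (cst 0 : R * R -> R) y = phi y by apply: filterS h => y ->.
have h1 : is_derive z (basis_vec i) phi 0 := near_eq_is_derive hn (is_derive_cst _ _ _).
by have [] := h1.
Qed.

End test_functions.

(** * Hausdorff measure and counting in a regular set *)

Section hausdorff.
Context {R : realType}.
Implicit Types (A B C : set R) (s delta r c : R).

Lemma le_diameter A x y : A x -> A y -> ((`|x - y|)%:E <= diameter A)%E.
Proof. by move=> Ax Ay; apply: ereal_sup_ubound; right; exists (x, y). Qed.

Lemma diameter_ge0 A : (0 <= diameter A)%E.
Proof. by apply: ereal_sup_ubound; left. Qed.

Lemma diameter0 : diameter (@set0 R) = 0%E.
Proof.
apply/le_anti; rewrite diameter_ge0 andbT; apply: ge_ereal_sup => y [->//|].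
by case=> z [].
Qed.

Lemma hausdorff_pre_ge0 s delta A : (0 <= hausdorff_pre s delta A)%E.
Proof.
apply: le_ereal_inf_tmp => _ [U _ <-].
by apply: nneseries_ge0 => ? _ _; exact: poweR_ge0.
Qed.

Lemma hausdorff_pre_le s delta delta' A : delta <= delta' ->
  (hausdorff_pre s delta' A <= hausdorff_pre s delta A)%E.
Proof.
move=> dd; apply: le_ereal_inf => _ [U [AU Ud] <-]; exists U => //.
by split => // k; rewrite (le_trans (Ud k))// lee_fin.
Qed.

Lemma hausdorff_pre_mono s delta A B : A `<=` B ->
  (hausdorff_pre s delta A <= hausdorff_pre s delta B)%E.
Proof.
move=> AB; apply: le_ereal_inf => _ [U [BU Ud] <-]; exists U => //.
by split => //; exact: subset_trans BU.
Qed.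

(* A set of diameter less than [eta] cannot meet both [A] and [B]. *)
Lemma hausdorff_pre_setU s delta eta A B : 0 < s -> delta < eta ->
  (forall x y, A x -> B y -> eta <= `|x - y|) ->
  (hausdorff_pre s delta A + hausdorff_pre s delta B
     <= hausdorff_pre s delta (A `|` B))%E.
Proof.
move=> s0 de sep; apply: le_ereal_inf_tmp => _ [U [ABU Ud] <-].
(* [V] keeps the pieces that meet [A] and [W] the others; the [set0] left in their place contributes
   [0] because [s] is positive. *)
pose V k := if `[< U k `&` A !=set0 >] then U k else set0.
pose W k := if `[< U k `&` A !=set0 >] then set0 else U k.
have d0 : (0 <= delta%:E)%E := le_trans (diameter_ge0 _) (Ud 0%N).
have hV : (hausdorff_pre s delta A <= \sum_(0 <= k <oo) (diameter (V k) `^ s))%E.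
  apply: ereal_inf_lbound; exists V => //; split.
    move=> x Ax; have [k _ Ukx] := ABU _ (or_introl Ax); exists k => //.
    by rewrite /V asboolT//; exists x.
  by move=> k; rewrite /V; case: ifP => _; rewrite ?diameter0.
have hW : (hausdorff_pre s delta B <= \sum_(0 <= k <oo) (diameter (W k) `^ s))%E.
  apply: ereal_inf_lbound; exists W => //; split.
    move=> y By; have [k _ Uky] := ABU _ (or_intror By); exists k => //.
    rewrite /W asboolF// => -[x [Ux Ax]].
    have := le_trans (le_diameter Ux Uky) (Ud k); rewrite lee_fin leNgt.
    by rewrite (lt_le_trans de)// sep.
  by move=> k; rewrite /W; case: ifP => _; rewrite ?diameter0.
apply: le_trans (leeD hV hW) _.
rewrite -nneseriesD; last 2 first.
- by move=> ? _ _; exact: poweR_ge0.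
- by move=> ? _ _; exact: poweR_ge0.
apply: lee_nneseries => [k _|k _]; first by rewrite adde_ge0// poweR_ge0.
by rewrite /V /W; case: ifP => _; rewrite diameter0 poweR0r ?gt_eqF// ?adde0 ?add0e.
Qed.

(** Iterates [hausdorff_pre_setU]. The strict bound by [m] yields for each ball a scale that already
    witnesses it, and the least of these finitely many scales serves all balls. *)
Lemma card_separated_balls s C (I : eqType) (S : seq I) (x : I -> R) r m :
  0 < s -> 0 < r -> uniq S ->
  {in S &, forall i j, i != j -> 4 * r <= `|x i - x j|} ->
  (forall i, i \in S -> (m%:E < hausdorff_measure s (ball (x i) r `&` C))%E) ->
  ((m *+ size S)%:E <=
    hausdorff_measure s (\bigcup_(i in [set` S]) (ball (x i) r `&` C)))%E.
Proof.
move=> s0 r0; pose Z (S' : seq I) := \bigcup_(i in [set` S']) (ball (x i) r `&` C).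
move=> uS sepS hS.
suff [delta d0 hd] : exists2 delta, 0 < delta &
    ((m *+ size S)%:E <= hausdorff_pre s delta (Z S))%E.
  by apply: le_trans hd _; apply: ereal_sup_ubound; exists delta.
elim: S uS sepS hS => [|i S IH] /=.
  by move=> _ _ _; exists 1 => //; exact: hausdorff_pre_ge0.
move=> /andP[iS uS] sepS hS.
have [||d1 d10 hd1] := IH uS.
- by move=> j k jS kS; apply: sepS; rewrite inE ?jS ?kS orbT.
- by move=> j jS; apply: hS; rewrite inE jS orbT.
have := hS i; rewrite inE eqxx => /(_ isT) /ereal_sup_gt [_ [d2 d20 <-] hd2].
(* Centres [4 * r] apart leave the balls at distance [2 * r], above the scale [d <= r]. *)
pose d := Num.min (Num.min d1 d2) r.
have dd1 : d <= d1 by rewrite !ge_min lexx.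
have dd2 : d <= d2 by rewrite !ge_min lexx orbT.
exists d; first by rewrite !lt_min d10 d20 r0.
apply: le_trans (_ : _ <= hausdorff_pre s d ((ball (x i) r `&` C) `|` Z S))%E _; last first.
  apply: hausdorff_pre_mono => y [yi|[j /= jS yj]].
    by exists i => //=; rewrite inE eqxx.
  by exists j => //=; rewrite inE jS orbT.
apply: le_trans (@hausdorff_pre_setU s d (2 * r) _ _ s0 _ _); last 2 first.
- by rewrite (@le_lt_trans _ _ r)// ?ge_min ?lexx ?orbT// ltr_pMl// ltr1n.
- move=> y z [yi _] [j /= jS [zj _]].
  have ij : i != j by apply: contraNneq iS => ->.
  have := sepS i j; rewrite !inE eqxx jS orbT => /(_ isT isT ij).
  move: yi zj; rewrite /ball /= => yi zj h.
  have := ler_normD (x i - y) (y - x j); rewrite addrA subrK => h1.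
  have := ler_normD (y - z) (z - x j); rewrite addrA subrK => h2.
  rewrite (distrC z) in h2; lra.
rewrite mulrS EFinD leeD//.
  by rewrite (le_trans (ltW hd2))// hausdorff_pre_le.
by rewrite (le_trans hd1)// hausdorff_pre_le.
Qed.

End hausdorff.

(** * Grid points near a regular set *)

Section grid.
Context {R : realType}.
Implicit Types (A B C : set R) (s delta r c : R) (M n : nat).

Definition grid M n (j : nat) : R := j%:R / 2 ^+ n - M%:R.

(** The indices run from [-M] to [M]. The radius is twice the spacing because bumps of radius [2^-n]
    must be selected whenever they are active within [2^-n] of [C]. *)
Definition near_grid C M n : {set 'I_(2 * M * 2 ^ n).+1} :=
  [set j : 'I_(2 * M * 2 ^ n).+1 | `[< exists2 c, C c & `|grid M n j - c| < 2 / 2 ^+ n >]].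

Lemma card_le_fibers (T J : finType) (S : {set T}) (f : T -> J) (m : R) :
  (forall g, #|[set j in S | f j == g]|%:R <= m) -> #|S|%:R <= #|J|%:R * m.
Proof.
move=> h; rewrite -sum1_card (partition_big f predT)//= natr_sum.
rewrite mulrC mulr_natr -sumr_const; apply: ler_sum => g _.
by apply: le_trans (h g); rewrite -sum1dep_card.
Qed.

Lemma dist_grid M n i j :
  `|grid M n i - grid M n j| = `|i%:R - j%:R| / 2 ^+ n.
Proof.
rewrite /grid opprB addrA subrK -mulrBl normrM [X in _ * X]ger0_norm//.
Qed.

Lemma modn_sep (i j d : nat) : (i %% d = j %% d)%N -> i != j ->
  d%:R <= `|i%:R - j%:R| :> R.
Proof.
wlog ij : i j / (i <= j)%N.
  move=> W; have [ij|/ltnW ji] := leqP i j; first exact: W.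
  by move=> h1 h2; rewrite distrC; apply: W => //; rewrite eq_sym.
move=> h1 h2; rewrite distrC -natrB// ger0_norm// ler_nat dvdn_leq//.
  by rewrite subn_gt0 ltn_neqAle h2.
by rewrite -eqn_mod_dvd//; apply/eqP.
Qed.

Lemma divn_close (i j L d : nat) : (0 < d)%N -> (i * L %/ d = j * L %/ d)%N ->
  `|i%:R - j%:R| * L%:R <= d%:R :> R.
Proof.
move=> d0; wlog ij : i j / (i <= j)%N.
  move=> W; have [ij|/ltnW ji] := leqP i j; first exact: W.
  by move=> h; rewrite distrC; apply: W.
move=> h; rewrite distrC -natrB// ger0_norm// -natrM ler_nat mulnBl.
rewrite (divn_eq (j * L) d) (divn_eq (i * L) d) h subnDl.
by rewrite (leq_trans (leq_subr _ _))// ltnW// ltn_pmod.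
Qed.

Lemma hausdorff_measure_mono s A B : A `<=` B ->
  (hausdorff_measure s A <= hausdorff_measure s B)%E.
Proof.
move=> AB; apply: ge_ereal_sup => _ [delta d0 <-].
apply: le_trans (hausdorff_pre_mono s delta AB) _.
by apply: ereal_sup_ubound; exists delta.
Qed.

Lemma powR_inv_mul (x s : R) : 0 < x -> x^-1 `^ s * x `^ s = 1.
Proof.
by move=> x0; rewrite -powRM ?invr_ge0 ?ltW// mulVf ?gt_eqF// powR1.
Qed.

(* Group the indices by their residue mod 8 and by cells of length less than
   [rho / 8], with [rho < diameter C].  Within a group the points of [C] near the
   grid points are [4 * 2^-n]-separated and lie in a common ball of radius [rho],
   so the lower and upper regularity bounds limit the size of the group. *)
Lemma card_near_grid s C M : 0 < s -> ahlfors_regular s C ->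
  exists2 K : R, 0 <= K & exists n0, forall n, (n0 <= n)%N ->
    #|near_grid C M n|%:R <= K * (2 ^+ n) `^ s.
Proof.
move=> s0 [c c0 regC].
pose J L : finType := ('I_8 * 'I_(2 * M * L).+1)%type.
(* A group is a residue mod 8 with a cell of length [1 / L]; the number of groups does not depend on
   [n]. *)
pose f L n (j : 'I_(2 * M * 2 ^ n).+1) : J L :=
  (inord (j %% 8), inord (j * L %/ 2 ^ n)).
have fib1 L n (i j : 'I_(2 * M * 2 ^ n).+1) : f L n i = f L n j -> (i %% 8 = j %% 8)%N.
  move=> [/(congr1 val) + _]; rewrite /= !inordK//; exact: ltn_pmod.
have fib2 L n (i j : 'I_(2 * M * 2 ^ n).+1) : f L n i = f L n j ->
    (i * L %/ 2 ^ n = j * L %/ 2 ^ n)%N.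
  have b (k : 'I_(2 * M * 2 ^ n).+1) : (k * L %/ 2 ^ n < (2 * M * L).+1)%N.
    have kL : (k * L <= 2 * M * L * 2 ^ n)%N.
      by rewrite [leqRHS]mulnAC leq_mul2r -ltnS ltn_ord orbT.
    by rewrite ltnS (leq_trans (leq_div2r (2 ^ n) kL))// mulnK// expn_gt0.
  by move=> [_ /(congr1 val)]; rewrite /= !inordK.
have pow_gt0 n : 0 < 2 ^+ n :> R by rewrite exprn_gt0.
have far L n (i j : 'I_(2 * M * 2 ^ n).+1) : f L n i = f L n j -> i != j ->
    8 / 2 ^+ n <= `|grid M n i - grid M n j|.
  move=> /fib1 h1 ij; rewrite dist_grid ler_pM2r ?invr_gt0//.
  exact: modn_sep.
(* If no positive radius lies below the diameter, [C] has at most one point and regularity is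
   vacuous. Two grid points of one group are then too far apart to be both near it. *)
have [[rho rho0 rhoC]|hC] := pselect (exists2 rho, 0 < rho & (rho%:E < diameter C)%E); last first.
  have C1 x y : C x -> C y -> x = y.
    move=> Cx Cy; apply: contrapT => /eqP xy; apply: hC.
    have d0 : 0 < `|x - y| by rewrite normr_gt0 subr_eq0.
    exists (`|x - y| / 2); first by rewrite divr_gt0.
    apply: lt_le_trans (le_diameter Cx Cy); rewrite lte_fin; lra.
  exists #|{: J 1%N}|%:R; first exact: ler0n.
  exists 0%N => n _; apply: (@card_le_fibers _ _ _ (f 1%N n)) => g.
  apply: le_trans (_ : 1 <= _); last first.
    have h2 : (1 : R) <= 2 ^+ n by rewrite exprn_ege1// ler1n.
    by have := @ler_powR _ _ h2 _ _ (ltW s0); rewrite powRr0.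
  rewrite -[1]/(1%:R) ler_nat; apply/card_le1_eqP => i j.
  rewrite !inE => /andP[/asboolP[x Cx xi] /eqP fi] /andP[/asboolP[y Cy yj] /eqP fj].
  apply/eqP; apply: contraT => ji.
  have := far _ _ _ _ (etrans fj (esym fi)) ji; rewrite distrC.
  rewrite (C1 _ _ Cy Cx) in yj.
  have := ler_distD x (grid M n i) (grid M n j); rewrite (distrC x).
  have := pow_gt0 n; rewrite -invr_gt0; lra.
(* Cells of length [1 / L] are shorter than [rho / 8], and [n >= L] forces [2^-n <= rho / 8]. *)
pose L := Num.bound (8 / rho).
have hL : 8 / rho < L%:R by apply: archi_boundP; rewrite divr_ge0// ltW.
exists (#|{: J L}|%:R * (2 * c ^+ 2 * rho `^ s)).
  by rewrite !mulr_ge0// ?exprn_ge0 ?powR_ge0 ?ltW.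
exists L => n Ln; rewrite -mulrA; apply: (@card_le_fibers _ _ _ (f L n)) => g.
set e : R := (2 ^+ n)^-1.
have e0 : 0 < e by rewrite invr_gt0.
have e_small : e <= rho / 8.
  rewrite /e -[rho / 8]invrK lef_pV2 ?posrE ?invr_gt0 ?divr_gt0// invf_div.
  apply: le_trans (ltW hL) _; apply: le_trans (_ : n%:R <= _); first by rewrite ler_nat.
  by rewrite -natrX ler_nat ltnW// ltn_expl.
set G := [set j in _ | _].
have [->|/finset.set0Pn [j0 Gj0]] := eqVneq G finset.set0.
  by rewrite cards0 !mulr_ge0// ?exprn_ge0 ?powR_ge0 ?ltW.
pose x (j : 'I_(2 * M * 2 ^ n).+1) := xget 0 [set c | C c /\ `|grid M n j - c| < 2 * e].
have hx (j : 'I_(2 * M * 2 ^ n).+1) : j \in G -> C (x j) /\ `|grid M n j - x j| < 2 * e.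
  rewrite !inE => /andP[/asboolP[y Cy yj] _].
  by have := @xgetPex _ 0 [set c | C c /\ `|grid M n j - c| < 2 * e]; apply; exists y.
have fG (i j : 'I_(2 * M * 2 ^ n).+1) : i \in G -> j \in G -> f L n i = f L n j.
  by rewrite !inE => /andP[_ /eqP ->] /andP[_ /eqP ->].
(* Halving the lower regularity bound gives the strict inequality that [card_separated_balls] asks
   for. *)
have := @card_separated_balls R s C _ (enum G) x e (c^-1 * e `^ s / 2) s0 e0 (enum_uniq _).
have -> : size (enum G) = #|G| by rewrite cardE.
have es0 : 0 < e `^ s by rewrite powR_gt0.
have erho : (e%:E < diameter C)%E by rewrite (le_lt_trans _ rhoC)// lee_fin; lra.
move=> /(_ _ _)/wrap[||].
(* Grid points of one group are [8 * e] apart, and moving each to its point of [C] costs less than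
   [2 * e], which leaves [4 * e]. *)
- move=> i j; rewrite !mem_enum => Gi Gj ij.
  have [_ hi] := hx _ Gi; have [_ hj] := hx _ Gj.
  have := far _ _ _ _ (fG _ _ Gi Gj) ij; rewrite -/e.
  have := ler_distD (x i) (grid M n i) (grid M n j).
  have := ler_distD (x j) (x i) (grid M n j); rewrite (distrC (x j)); lra.
- move=> i; rewrite mem_enum => Gi; have [Cxi _] := hx _ Gi.
  have /andP[+ _] := regC _ _ Cxi e0 erho; apply: lt_le_trans.
  by rewrite lte_fin ltr_pdivrMr// ltr_pMr ?mulr_gt0 ?invr_gt0// ltr1n.
have [Cx0 hx0] := hx _ Gj0.
have /andP[_ hup] := regC _ _ Cx0 rho0 rhoC.
move=> h; have {h} := le_trans h (le_trans (hausdorff_measure_mono s _) hup).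
rewrite lee_fin -[_ *+ #|G|]mulr_natr.
move=> /(_ _)/wrap[|h].
  (* From [x j0] to [y] through the two grid points and [x j], the distance is below
     [2 * e + rho / 8 + 2 * e + e], hence below [rho]. *)
  move=> y [j /=]; rewrite mem_enum => Gj [yj Cy]; split => //.
  have [_ hj] := hx _ Gj.
  have h1 : `|grid M n j0 - grid M n j| <= rho / 8.
    rewrite dist_grid -/e.
    have L0 : 0 < L%:R :> R by rewrite (lt_trans _ hL)// divr_gt0.
    have := @divn_close j0 j L (2 ^ n) (expn_gt0 _ _) (fib2 _ _ _ _ (fG _ _ Gj0 Gj)).
    rewrite natrX -ler_pdivlMr// => h1.
    apply: le_trans (_ : 2 ^+ n / L%:R * e <= _).
      by rewrite ler_pM2r.
    rewrite mulrAC /e mulfV ?gt_eqF// mul1r -[rho / 8]invrK lef_pV2 ?posrE ?invr_gt0 ?divr_gt0// invf_div.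
    exact: ltW.
  move: yj; rewrite /ball /= => yj.
  have := ler_distD (grid M n j0) (x j0) y; rewrite (distrC (x j0) (grid _ _ _)).
  have := ler_distD (grid M n j) (grid M n j0) y.
  have := ler_distD (x j) (grid M n j) y; lra.
rewrite -(@ler_pM2l _ (c^-1 * e `^ s / 2)) ?divr_gt0 ?mulr_gt0 ?invr_gt0//.
apply: (le_trans h); rewrite le_eqVlt; apply/orP; left; apply/eqP.
have := @powR_inv_mul (2 ^+ n) s (pow_gt0 n); rewrite -/e => ee.
transitivity (c * rho `^ s * (e `^ s * (2 ^+ n) `^ s)); first by rewrite ee mulr1.
by field; rewrite gt_eqF.
Qed.

End grid.

(** * Cutoff functions *)

Section cutoff.
Context {R : realType}.
Implicit Types (C : set R) (s x c : R) (M n : nat).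
Local Notation leb := (@lebesgue_measure R).

Lemma is_derive1_sum (I : Type) (r : seq I) (P : pred I) (F F' : I -> R -> R) x :
  (forall i, is_derive x 1 (F i) (F' i x)) ->
  is_derive x 1 (fun x => \sum_(i <- r | P i) F i x) (\sum_(i <- r | P i) F' i x).
Proof.
move=> hF; elim: r => [|i r IH].
  rewrite big_nil (_ : (fun _ => _) = cst 0); first exact: is_derive_cst.
  by apply/funext => y; rewrite big_nil.
rewrite big_cons; case: (boolP (P i)) => Pi.
  rewrite (_ : (fun _ => _) = (F i + (fun x => \sum_(i <- r | P i) F i x))).
    exact: is_derive_eq (is_deriveD (hF i) IH) _.
  by apply/funext => y; rewrite big_cons Pi.
rewrite (_ : (fun _ => _) = (fun x => \sum_(i <- r | P i) F i x))//.
by apply/funext => y; rewrite big_cons (negbTE Pi).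
Qed.

Lemma exists_union_itv (I : eqType) (r : seq I) (t : I -> R) (e : R) : 0 < e ->
  exists N : set R, [/\ measurable N, (leb N <= (2 * e *+ size r)%:E)%E &
    forall x, ~ N x -> forall i, i \in r -> e < `|x - t i|].
Proof.
move=> e0; elim: r => [|i r [N [mN hN fN]]].
  by exists set0; rewrite measure0; split.
exists (`[t i - e, t i + e] `|` N); split.
- by apply: measurableU => //; exact: measurable_itv.
- apply: le_trans (measureU2 _ _ _) _ => //=.
  rewrite mulrS EFinD leeD// lebesgue_measure_itv /= lte_fin ltrBlDr -addrA ltrDl addr_gt0//.
  by rewrite EFinN -EFinB lee_fin; lra.
- move=> x /not_orP [xi xN] j; rewrite inE => /predU1P[->|jr]; last exact: fN.
  rewrite ltNge; apply/negP => xt; apply: xi => /=.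
  by rewrite in_itv /= -ler_distlC distrC.
Qed.

Lemma sum_partition (beta sigma : R -> R) m z :
  (forall x, beta x = sigma (x + 1) - sigma x) ->
  \sum_(j < m) beta (z - j%:R) = sigma (z + 1) - sigma (z + 1 - m%:R).
Proof.
move=> hb; elim: m => [|m IH]; first by rewrite big_ord0 subr0 subrr.
rewrite big_ord_recr /= IH hb -natr1 (_ : z - m%:R + 1 = z + 1 - m%:R); last by ring.
rewrite (_ : z + 1 - (m%:R + 1) = z - m%:R); last by ring.
by rewrite addrA subrK.
Qed.

Variables (sigma beta beta' : R -> R) (B : R).
Hypotheses (sb : smooth1 beta) (sb' : smooth1 beta')
  (hbeta : forall x, is_derive x 1 beta (beta' x))
  (betaE : forall x, beta x = sigma (x + 1) - sigma x)
  (sigma0 : forall x, x <= 0 -> sigma x = 0) (sigma1 : forall x, 1 <= x -> sigma x = 1)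
  (beta0 : forall x, 1 <= `|x| -> beta x = 0)
  (beta'0 : forall x, 1 < `|x| -> beta' x = 0)
  (B0 : 0 <= B) (betaB : forall x, `|beta x| <= B) (beta'B : forall x, `|beta' x| <= B).

Definition bump_at M n j x := beta (2 ^+ n * (x + M%:R) - j%:R).

Lemma bump_grid M n j x :
  2 ^+ n * (x + M%:R) - j%:R = 2 ^+ n * (x - grid M n j) :> R.
Proof. by rewrite /grid; field; rewrite expf_neq0. Qed.

Lemma bumpE M n j : bump_at M n j = (fun x => beta (2 ^+ n * x + (2 ^+ n * M%:R - j%:R))).
Proof. by apply/funext => x; rewrite /bump_at mulrDr addrA. Qed.

Lemma smooth1_bump M n j : smooth1 (bump_at M n j).
Proof. by rewrite bumpE; exact: smooth1_affine. Qed.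

Lemma sum_bump M n x : `|x| <= M%:R ->
  \sum_(j < (2 * M * 2 ^ n).+1) bump_at M n j x = 1.
Proof.
rewrite ler_norml => /andP[x1 x2].
have p0 : 0 < 2 ^+ n :> R by rewrite exprn_gt0.
have z0 : 0 <= 2 ^+ n * (x + M%:R) by rewrite mulr_ge0 ?(ltW p0)//; lra.
(* With [z = 2 ^+ n * (x + M%:R)] the sum telescopes to [sigma (z + 1) - sigma (z - 2 * M * 2 ^ n)];
   the extra last index makes this [1 - 0] up to the right endpoint. *)
rewrite (sum_partition _ _ betaE) sigma1 ?lerDr// sigma0 ?subr0//.
rewrite -(natr1 (2 * M * 2 ^ n)) opprD addrACA subrr addr0 subr_le0 natrM natrX natrM.
by rewrite mulrC ler_pM2r//; lra.
Qed.

(** Remove from [1] the bumps centred at grid points near [C]. The count of these points bounds the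
    measure of their supports, and the bounded overlap of the bumps bounds [1 - chi] and [chi']. *)
Lemma exists_cutoff s C M : 0 < s -> ahlfors_regular s C ->
  exists2 K : R, 0 <= K & exists n0, forall n, (n0 <= n)%N ->
  exists (chi chi' : R -> R) (N : set R),
  [/\ [/\ smooth1 chi, smooth1 chi' & forall x, is_derive x 1 chi (chi' x)],
      measurable N /\ (leb N <= (K * ((2 ^+ n) `^ s / 2 ^+ n))%:E)%E,
      forall x, ~ N x -> chi x = 1 /\ chi' x = 0,
      forall x, `|1 - chi x| <= K /\ `|chi' x| <= K * 2 ^+ n &
      forall c, C c -> `|c| < M%:R -> \forall x \near c, chi x = 0].
Proof.
move=> s0 regC.
have [K K0 [n0 hK]] := card_near_grid M s0 regC.
(* [2 * K] comes from intervals of length [2 * e] around the selected grid points, [3 * B] from the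
   overlap of at most three bumps. *)
exists (2 * K + 3 * B); first by rewrite addr_ge0 ?mulr_ge0.
exists n0 => n n0n.
have p0 : 0 < 2 ^+ n :> R by rewrite exprn_gt0.
set S := near_grid C M n.
pose e : R := (2 ^+ n)^-1.
have e0 : 0 < e by rewrite invr_gt0.
have [N [mN leN hN]] := @exists_union_itv _ (enum S) (fun j : 'I__ => grid M n j) e e0.
pose bump' j x : R := 2 ^+ n * beta' (2 ^+ n * (x + M%:R) - j%:R).
exists (fun x => 1 - \sum_(j <- enum 'I_(2 * M * 2 ^ n).+1 | j \in S) bump_at M n j x).
exists (fun x => 0 - \sum_(j <- enum 'I_(2 * M * 2 ^ n).+1 | j \in S) bump' j x).
exists N; split.
- split.
  + apply: smooth1B; first exact: smooth1_cst.
    by apply: smooth1_sum => j; exact: smooth1_bump.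
  + apply: smooth1B; first exact: smooth1_cst.
    apply: smooth1_sum => j; apply: smooth1M; first exact: smooth1_cst.
    have := @smooth1_affine _ beta' (2 ^+ n) (2 ^+ n * M%:R - j%:R) sb'.
    by congr smooth1; apply/funext => x; rewrite mulrDr addrA.
  + move=> x.
    have hS : is_derive x 1
        (fun x => \sum_(j <- enum 'I_(2 * M * 2 ^ n).+1 | j \in S) bump_at M n j x)
        (\sum_(j <- enum 'I_(2 * M * 2 ^ n).+1 | j \in S) bump' j x).
      apply: (@is_derive1_sum _ _ _ (fun j : 'I_(2 * M * 2 ^ n).+1 => bump_at M n j)
        (fun j : 'I_(2 * M * 2 ^ n).+1 => bump' j)) => j.
      rewrite bumpE /bump' mulrDr -addrA; exact: is_derive1_affine.
    exact: (is_deriveB (is_derive_cst (1 : R) x 1) hS).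
- split => //; apply: (le_trans leN); rewrite lee_fin -cardE.
  apply: le_trans (_ : 2 * K * ((2 ^+ n) `^ s / 2 ^+ n) <= _); last first.
    by rewrite ler_wpM2r ?divr_ge0 ?powR_ge0 ?(ltW p0)// lerDl mulr_ge0.
  rewrite -mulr_natr mulrAC -/e (mulrA (2 * K)) ler_pM2r// -mulrA ler_pM2l//.
  exact: hK.
- move=> x Nx.
  have h j : j \in S -> 1 < `|2 ^+ n * (x + M%:R) - j%:R|.
    move=> jS; rewrite bump_grid normrM (gtr0_norm p0) mulrC -ltr_pdivrMr// mul1r.
    by apply: hN; rewrite ?mem_enum.
  rewrite !big1 ?subr0// => j jS.
    by rewrite /bump' beta'0 ?mulr0// h.
  by rewrite /bump_at beta0// ltW// h.
- move=> x; split.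
  + rewrite opprB addrC subrK.
    have := sum_norm_translates_le B0 betaB (fun x h => beta0 (ltW h))
              (2 * M * 2 ^ n).+1 (2 ^+ n * (x + M%:R)) => hb.
    apply: le_trans (ler_norm_sum _ _ _) _.
    apply: le_trans (_ : 3 * B <= _); last by rewrite lerDr mulr_ge0.
    apply: le_trans hb; rewrite big_enum_cond /= [leRHS](bigID (mem S)) /= lerDl.
    exact: sumr_ge0.
  + rewrite sub0r normrN.
    have := sum_norm_translates_le B0 beta'B beta'0
              (2 * M * 2 ^ n).+1 (2 ^+ n * (x + M%:R)) => hb.
    apply: le_trans (ler_norm_sum _ _ _) _.
    apply: le_trans (_ : 3 * B * 2 ^+ n <= _); last first.
      by rewrite ler_pM2r// lerDr mulr_ge0.
    rewrite big_enum_cond /= -ler_pdivrMr// mulr_suml.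
    apply: le_trans hb; rewrite [leRHS](bigID (mem S)) /= ler_wpDr ?sumr_ge0//.
    apply: ler_sum => j _.
    by rewrite /bump' normrM (gtr0_norm p0) mulrAC mulfV ?gt_eqF// mul1r.
- move=> c Cc cM.
  near=> x.
  have xM : `|x| <= M%:R.
    by apply/ltW; near: x; exact: (cvgr_lt _ (@norm_continuous _ _ c) _ cM).
  have xc : `|c - x| < e by near: x; exact: cvgr_dist_lt.
  (* Writing [1] as the full partition of unity leaves the unselected bumps. One active at [x] would
     have its centre within [2 * e] of [c] and be selected. *)
  rewrite -(sum_bump n xM) [X in X - _](bigID (mem S)) /= big_enum_cond /=.
  rewrite addrAC subrr add0r big1// => j jS.
  apply: beta0; rewrite leNgt; apply: contra jS => h.
  rewrite inE; apply/asboolP; exists c => //.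
  move: h; rewrite bump_grid normrM (gtr0_norm p0) mulrC -ltr_pdivlMr// mul1r -/e => h.
  have := ler_distD x (grid M n j) c; rewrite -/e (distrC _ x) (distrC x c).
  lra.
Unshelve. all: by end_near. Qed.

End cutoff.

(** * Measure and integration on the plane *)

Section plane_measurability.
Context {R : realType}.
Local Notation mR := (measurableTypeR R).
Local Notation leb := (@lebesgue_measure R).
Local Notation mu2 := (@lebesgue_measure2 R).

(** An open set is the countable union of the rational squares that it contains, and these are
    measurable rectangles. *)
Lemma open_measurable2 (O : set (R * R)) : open O -> measurable (O : set (mR * mR)).
Proof.
move=> oO.
pose r (n : nat) : R := n.+1%:R^-1.
pose Q (t : rat * rat * nat) : set (mR * mR) :=
  (ball (ratr t.1.1 : R) (r t.2)) `*` (ball (ratr t.1.2 : R) (r t.2)).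
have mQ t : measurable (Q t) by apply: measurableX; exact: measurable_ball.
pose P t : set (mR * mR) := if `[< Q t `<=` O >] then Q t else set0.
have -> : O = \bigcup_t P t.
  apply/seteqP; split => [z Oz|z [t _]]; last first.
    have [QO|QO] := pselect (Q t `<=` O); first by rewrite /P asboolT//; exact: QO.
    by rewrite /P asboolF.
  have /nbhs_ballP [e /= e0 eO] : nbhs z O by move: oO; rewrite openE; apply.
  have [n rn] : exists n, r n < e / 2.
    have e20 : 0 < (e / 2)^-1 by rewrite invr_gt0 divr_gt0.
    have := archi_boundP (ltW e20); set m := Num.bound _ => hm.
    exists m; rewrite /r -[e / 2]invrK ltf_pV2 ?posrE//.
    by rewrite (lt_le_trans hm)// ler_nat.
  have r0 : 0 < r n by rewrite invr_gt0.
  have rat_close (a : R) : exists q : rat, `|ratr q - a| < r n.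
    have [|q] := @rat_in_itvoo R (a - r n) (a + r n); first by rewrite ltrBlDr -addrA ltrDl addr_gt0.
    by rewrite in_itv /= -ltr_distl => ?; exists q.
  have [q1 h1] := rat_close z.1; have [q2 h2] := rat_close z.2.
  exists (q1, q2, n) => //; rewrite /P asboolT.
    by split; rewrite /ball /= ?h1 ?h2.
  move=> y [y1 y2]; apply: eO; split => /=.
    have := ler_distD (ratr q1) z.1 y.1; move: y1; rewrite /ball /= (distrC z.1 (ratr q1)); lra.
  have := ler_distD (ratr q2) z.2 y.2; move: y2; rewrite /ball /= (distrC z.2 (ratr q2)); lra.
apply: countable_bigcupT_measurable => [|t]; first exact: countableP.
by rewrite /P; case: ifP.
Qed.

Lemma continuous_measurable2 (f : R * R -> R) : continuous f ->
  measurable_fun setT (f : mR * mR -> R).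
Proof.
move=> cf; apply: (measurability (@RGenOInfty.G R) (RGenOInfty.measurableE R)).
move=> _ [_ [x ->] <-]; rewrite setTI; apply: open_measurable2.
by apply: open_comp; [move=> z _; exact: cf|exact: interval_open].
Qed.

Lemma lebesgue_measure2X (A B : set R) : measurable A -> measurable B ->
  mu2 (A `*` B) = (leb A * leb B)%E.
Proof. by move=> mA mB; exact: product_measure1E. Qed.

End plane_measurability.

(** * Hölder bounds on sets of finite measure *)

Section weighted.
Context d (T : measurableType d) (R : realType) (mu : {measure set T -> \bar R}).
Local Open Scope ereal_scope.

(** Hölder's inequality against [\1_A], whose norm for the conjugate exponent [q] is the measure of
    [A] to the power [q^-1 = 1 - r^-1]. *)
Lemma Lfun_indic_le_fin (r : R) (f : T -> R) : (1 < r)%R -> f \in Lfun mu r%:E ->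
  exists2 K : R, (0 <= K)%R & forall A, measurable A -> mu A < +oo ->
    \int[mu]_x `|f x * \1_A x|%:E <= (K * fine (mu A) `^ (1 - r^-1))%:E.
Proof.
move=> r1 /andP[/[!inE]/= mf ff].
have r0 : (0 < r)%R by rewrite (lt_trans ltr01).
pose q : R := (1 - r^-1)^-1%R.
have q0 : (0 < q)%R by rewrite invr_gt0 subr_gt0 invf_lt1.
exists (fine ('N[mu]_r%:E[EFin \o f])); first by rewrite fine_ge0// Lnorm_ge0.
move=> A mA Afin.
have mI : measurable_fun setT (\1_A : T -> R) by exact: measurable_indic.
have := @hoelder _ _ _ mu f (\1_A) r q mf mI r0 q0.
rewrite invrK addrC subrK => /(_ erefl); rewrite Lnorm1.
set N2 := 'N[mu]_q%:E[_].
have -> : N2 = (fine (mu A) `^ (1 - r^-1))%:E.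
  rewrite /N2 unlock invrK.
  under eq_integral.
    move=> x _.
    have -> : (`|(EFin \o \1_A) x| `^ q = (\1_A x)%:E).
      rewrite /= indicE; case: (x \in A) => /=.
        by rewrite normr1 powR1.
      by rewrite normr0 powR0// gt_eqF.
    over.
  by rewrite integral_indic// setIT -poweR_EFin fineK// ge0_fin_numE.
move=> h; rewrite EFinM fineK; last by rewrite ge0_fin_numE ?Lnorm_ge0.
exact: h.
Qed.

Lemma Lfun_indic_le_oo (f : T -> R) : f \in Lfun mu +oo ->
  exists2 K : R, (0 <= K)%R & forall A, measurable A -> mu A < +oo ->
    \int[mu]_x `|f x * \1_A x|%:E <= (K * fine (mu A))%:E.
Proof.
move=> /andP[/[!inE]/= mf]; rewrite /finite_norm unlock => ff.
have [K hK] : exists K : R, {ae mu, forall x, (`|f x| <= K)%R}.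
  move: ff; case: ifPn => [mu0|mu0 _].
    by move=> /(@ess_supr_bounded _ _ _ mu (Num.norm \o f)).
  (* On a space of measure zero every bound holds almost everywhere. *)
  have {}mu0 : mu setT = 0.
    by apply/eqP; rewrite eq_le measure_ge0 andbT leNgt.
  exists 0%R; exists setT; split => //.
exists `|K|%R => // A mA Afin.
have mI : measurable_fun setT (\1_A : T -> R) by exact: measurable_indic.
have -> : (`|K| * fine (mu A))%:E = \int[mu]_x ((`|K|%:E * (\1_A x)%:E)).
  rewrite ge0_integralZl//; last by apply/measurable_EFinP.
  by rewrite integral_indic// setIT EFinM fineK// ge0_fin_numE.
apply: ae_ge0_le_integral => //.
- by apply/measurable_EFinP; apply: measurableT_comp => //; exact: measurable_funM.
- by apply/measurable_EFinP; exact: measurable_funM.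
apply: filterS hK => x hx _; rewrite -EFinM lee_fin normrM.
rewrite (ger0_norm (_ : 0 <= \1_A x)%R) ?indicE ?ler0n//.
by rewrite ler_wpM2r// (le_trans hx)// ler_norm.
Qed.

Lemma weighted_le (f w : T -> R) (A : set T) (B k : R) :
  measurable_fun setT f -> measurable_fun setT w -> measurable A ->
  (forall x, `|w x| <= B)%R -> (forall x, ~ A x -> w x = 0%R) -> (0 <= B)%R ->
  \int[mu]_x `|f x * \1_A x|%:E <= k%:E ->
  mu.-integrable setT (EFin \o (fun x => f x * w x)%R) /\
  (`|\int[mu]_(x in setT) (f x * w x)| <= B * k)%R.
Proof.
move=> mf mw mA wB w0 B0 hk.
have mI : measurable_fun setT (\1_A : T -> R) by exact: measurable_indic.
have mfI : measurable_fun setT (fun x => `|f x * \1_A x|%:E).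
  by apply/measurable_EFinP; apply: measurableT_comp => //; exact: measurable_funM.
have mfw : measurable_fun setT (EFin \o (fun x => f x * w x)%R).
  by apply/measurable_EFinP; exact: measurable_funM.
have h : \int[mu]_x `|(f x * w x)%R%:E| <= (B * k)%:E.
  apply: le_trans (_ : \int[mu]_x (B%:E * `|f x * \1_A x|%:E) <= _); last first.
    rewrite ge0_integralZl// EFinM lee_wpmul2l//.
  apply: ge0_le_integral => //.
  - exact: measurableT_comp.
  - exact: emeasurable_funM.
  move=> x _; rewrite -EFinM lee_fin !normrM.
  have [Ax|nAx] := pselect (A x).
    rewrite indicE mem_set// normr1 mulr1 mulrC ler_wpM2r//.
  by rewrite w0// normr0 mulr0 !mulr_ge0.
have ifw : mu.-integrable setT (EFin \o (fun x => f x * w x)%R).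
  by apply/integrableP; split => //; apply: le_lt_trans h _; rewrite ltry.
split => //.
apply: le_trans (le_normr_Rintegral _ ifw) _ => //.
rewrite -lee_fin /Rintegral fineK //.
rewrite ge0_fin_numE; first by apply: le_lt_trans h _; rewrite ltry.
by apply: integral_ge0 => x _; rewrite lee_fin.
Qed.

End weighted.

Section exponent.
Context {R : realType}.
Local Open Scope ring_scope.

(** Take [alpha = 1 - 1/p], read as [1] when [p] is infinite; the threshold on [p] is exactly
    [1 < (2 - s) * alpha]. From here on the estimates see [p] only through [alpha]. *)
Lemma Lfun_weighted_le (s : R) (p : \bar R) : 0 < s < 1 ->
  (((2 - s) / (1 - s))%:E < p)%E ->
  exists alpha : R, [/\ 0 < alpha, 1 < (2 - s) * alpha &
    forall d (T : measurableType d) (mu : {measure set T -> \bar R}) (f : T -> R),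
    f \in Lfun mu p -> measurable_fun setT f /\ exists2 K : R, 0 <= K &
    forall A, measurable A -> (mu A < +oo)%E ->
    forall (w : T -> R) B, measurable_fun setT w -> 0 <= B ->
    (forall x, `|w x| <= B) -> (forall x, ~ A x -> w x = 0) ->
    mu.-integrable setT (EFin \o (fun x => f x * w x)) /\
    `|\int[mu]_(x in setT) (f x * w x)| <= B * (K * fine (mu A) `^ alpha)].
Proof.
move=> /andP[s0 s1]; case: p => [r| _|//]; last first.
  exists 1; split => [//||d T mu f fp]; first by lra.
  have mf : measurable_fun setT f by move: fp => /andP[/[!inE]].
  split=> //; have [K K0 hK] := Lfun_indic_le_oo fp.
  exists K => // A mA Afin w B mw B0 wB w0.
  apply: (@weighted_le _ _ _ _ f w A) => //.
  by rewrite powRr1 ?fine_ge0//; exact: hK.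
rewrite lte_fin => sr.
have r1 : 1 < r.
  by apply: lt_trans sr; rewrite ltr_pdivlMr; lra.
have r0 : 0 < r by lra.
exists (1 - r^-1); split.
- by rewrite subr_gt0 invf_lt1.
- rewrite mulrBr mulr1 ltrBrDr -ltrBrDl ltr_pdivrMr//.
  by move: sr; rewrite ltr_pdivrMr; lra.
move=> d T mu f fp.
have mf : measurable_fun setT f by move: fp => /andP[/[!inE]].
split=> //; have [K K0 hK] := Lfun_indic_le_fin r1 fp.
exists K => // A mA Afin w B mw B0 wB w0.
by apply: (@weighted_le _ _ _ _ f w A) => //; exact: hK.
Qed.

End exponent.

(** * Pairings with bounded weights *)

Section pairing.
Context {R : realType}.
Implicit Types (f phi w : R * R -> R) (a b : R -> R) (A : set R).
Local Notation mR := (measurableTypeR R).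
Local Notation leb := (@lebesgue_measure R).
Local Notation mu2 := (@lebesgue_measure2 R).

Lemma test_function_setT Omega phi : test_function Omega phi -> test_function setT phi.
Proof. by move=> [s c _]; split. Qed.

Lemma test_function_partial Omega phi i :
  test_function Omega phi -> test_function Omega (partial i phi).
Proof.
move=> [sphi cphi sub].
have h : closure [set z | partial i phi z != 0] `<=` closure [set z | phi z != 0].
  rewrite [X in _ `<=` X](closure_id _).1; last exact: closed_closure.
  apply: closureS => z /=; apply: contraNP => hz.
  apply/eqP; apply: partial_eq0.
  have : open (~` closure [set z | phi z != 0]) by rewrite openC; exact: closed_closure.
  rewrite openE => /(_ _ hz); apply: filterS => y hy.
  apply/eqP; apply: contra_notT hy => py; exact: subset_closure.
split; first exact: smooth_partial.
- apply: subclosed_compact cphi h; exact: closed_closure.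
- exact: subset_trans h sub.
Qed.

Lemma test_function_bounded phi : test_function setT phi ->
  exists2 B, 0 <= B & forall z, `|phi z| <= B.
Proof.
move=> [sphi cphi _].
have : bounded_set (phi @` closure [set z | phi z != 0]).
  apply: compact_bounded; apply: continuous_compact => //.
  apply: continuous_subspaceT; exact: smooth_continuous.
move=> [M [_ hM]]; exists (`|M| + 1); first by rewrite addr_ge0.
have M1 : M < `|M| + 1 by rewrite (le_lt_trans (ler_norm _))// ltrDl.
move=> z; have [->|z0] := eqVneq (phi z) 0; first by rewrite normr0 addr_ge0.
by apply: hM M1 _ _; exists z => //; exact: (@subset_closure _ [set z | phi z != 0]).
Qed.

Definition pairing f w : R := \int[mu2]_(z in setT) (f z * w z).

(** The property of planar functions in [Lfun] that [Lfun_weighted_le] provides, isolated so that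
    the integration by parts can be done without reference to [p]. *)
Definition weight_bounded (alpha : R) f := measurable_fun setT (f : mR * mR -> R) /\
  exists2 K : R, 0 <= K & forall A : set (mR * mR), measurable A -> (mu2 A < +oo)%E ->
    forall w B, measurable_fun setT (w : mR * mR -> R) -> 0 <= B ->
    (forall z, `|w z| <= B) -> (forall z, ~ A z -> w z = 0) ->
    mu2.-integrable setT (EFin \o (fun z => f z * w z)) /\
    `|pairing f w| <= B * (K * fine (mu2 A) `^ alpha).

Lemma test_function_measurable w : test_function setT w ->
  measurable_fun setT (w : mR * mR -> R).
Proof. by move=> [sw _ _]; apply: continuous_measurable2; exact: smooth_continuous. Qed.

Lemma itv_measure (a b : R) : a <= b -> leb `[a, b] = (b - a)%:E.
Proof.
rewrite lebesgue_measure_itv /= lte_fin le_eqVlt => /predU1P[->|->].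
  by rewrite ltxx subrr.
by rewrite -EFinB.
Qed.

Lemma pairing_integrable alpha f w : weight_bounded alpha f -> test_function setT w ->
  mu2.-integrable setT (EFin \o (fun z => f z * w z)).
Proof.
move=> [mf [K K0 hK]] tw.
have [B B0 wB] := test_function_bounded tw.
have [M hM] := test_function_window tw.
pose A : set (mR * mR) := `[- M%:R, M%:R]%classic `*` `[- M%:R, M%:R]%classic.
have MM : - M%:R <= M%:R :> R by rewrite (@le_trans _ _ 0)// oppr_le0.
have [||z zA|//] := hK A _ _ w B (test_function_measurable tw) B0 wB.
- by apply: measurableX; exact: measurable_itv.
- by rewrite /A lebesgue_measure2X ?itv_measure// -?EFinM ?ltry//; exact: measurable_itv.
- apply/eqP; apply: contra_notT zA => /hM [/ltW h1 /ltW h2].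
  by split; rewrite /= in_itv/= -ler_norml.
Qed.

Lemma pairingD alpha f w1 w2 : weight_bounded alpha f ->
  test_function setT w1 -> test_function setT w2 ->
  pairing f (fun z => w1 z + w2 z) = pairing f w1 + pairing f w2.
Proof.
move=> bf t1 t2; rewrite /pairing -RintegralD//.
- by apply: eq_Rintegral => z _; rewrite mulrDr.
- exact: pairing_integrable bf t1.
- exact: pairing_integrable bf t2.
Qed.

Lemma pairingZ alpha f w (k : R) : weight_bounded alpha f -> test_function setT w ->
  pairing f (fun z => k * w z) = k * pairing f w.
Proof.
move=> bf tw; rewrite /pairing -RintegralZl//.
- by apply: eq_Rintegral => z _; rewrite mulrCA.
- exact: pairing_integrable bf tw.
Qed.

Definition tensor phi a b (z : R * R) : R := phi z * (a z.1 * b z.2).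

Lemma test_tensor phi a b : test_function setT phi -> smooth1 a -> smooth1 b ->
  test_function setT (tensor phi a b).
Proof. by move=> tphi sa sb; apply: test_function_tensor => // z []. Qed.

(** The constant is chosen before the functions and the sets, so it serves all scales at once. *)
Lemma tensor_bound alpha f : weight_bounded alpha f -> 0 < alpha ->
  exists2 K : R, 0 <= K & forall phi a b (A1 A2 : set R) (B1 B2 B3 m1 m2 : R),
  test_function setT phi -> smooth1 a -> smooth1 b ->
  measurable A1 -> measurable A2 -> (leb A1 <= m1%:E)%E -> (leb A2 <= m2%:E)%E ->
  (forall z, `|phi z| <= B1) -> (forall x, `|a x| <= B2) -> (forall x, `|b x| <= B3) ->
  (forall z, ~ (A1 z.1 /\ A2 z.2) -> tensor phi a b z = 0) ->
  `|pairing f (tensor phi a b)| <= B1 * (B2 * B3) * (K * (m1 * m2) `^ alpha).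
Proof.
move=> [mf [K K0 hK]] al0; exists K => // phi a b A1 A2 B1 B2 B3 m1 m2 tphi sa sb mA1 mA2 l1 l2 h1 h2 h3 h0.
have B10 : 0 <= B1 := le_trans (normr_ge0 _) (h1 (0, 0)).
have B20 : 0 <= B2 := le_trans (normr_ge0 _) (h2 0).
have B30 : 0 <= B3 := le_trans (normr_ge0 _) (h3 0).
have m10 : 0 <= m1 by rewrite -lee_fin (le_trans _ l1).
have m20 : 0 <= m2 by rewrite -lee_fin (le_trans _ l2).
have mA : (mu2 (A1 `*` A2) <= (m1 * m2)%:E)%E.
  by rewrite lebesgue_measure2X// EFinM lee_pmul.
have fA : (mu2 (A1 `*` A2) < +oo)%E by rewrite (le_lt_trans mA)// ltry.
have [|||z hz|_ h] := hK (A1 `*` A2) _ fA _ (B1 * (B2 * B3))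
   (test_function_measurable (test_tensor tphi sa sb)).
- exact: measurableX.
- by rewrite !mulr_ge0.
- by move=> z; rewrite /tensor !normrM !ler_pM// mulr_ge0.
- exact: h0.
apply: (le_trans h).
rewrite ler_wpM2l ?mulr_ge0// ler_wpM2l// ge0_ler_powR ?nnegrE ?fine_ge0 ?mulr_ge0 ?(ltW al0)//.
by rewrite -lee_fin fineK// ge0_fin_numE.
Qed.

End pairing.

(** * Geometric decay *)

Section decay.
Context {R : realType}.
Implicit Types (C F : set R) (s x : R) (M n : nat).
Local Notation leb := (@lebesgue_measure R).

Definition eps n : R := (2 ^+ n)^-1.

Lemma eps_gt0 n : 0 < eps n. Proof. by rewrite invr_gt0 exprn_gt0. Qed.

Lemma eps_powR n (a : R) : eps n `^ a = (2^-1 `^ a) ^+ n.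
Proof.
by rewrite /eps -exprVn -powR_mulrn ?invr_ge0// -powRrM mulrC powRrM powR_mulrn// powR_ge0.
Qed.

Lemma half_powR_lt1 (a : R) : 0 < a -> 0 <= (2^-1 : R) `^ a < 1.
Proof.
have h1 : (1 : R) `^ a = 1 by rewrite powR1.
move=> a0; rewrite powR_ge0 /= -[ltRHS]h1.
by rewrite gt0_ltr_powR ?nnegrE ?invr_ge0// invf_lt1// ltr1n.
Qed.

Lemma geometric_small (q K e : R) n0 : 0 <= q < 1 -> 0 <= K -> 0 < e ->
  exists2 n, (n0 <= n)%N & K * q ^+ n < e.
Proof.
move=> /andP[q0 q1] K0 e0.
have e1 : 0 < e / (K + 1) by rewrite divr_gt0// ltr_wpDl.
have /cvgr0Pnorm_lt /(_ _ e1) [N _ hN] : q ^+ n @[n --> \oo] --> 0.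
  by apply: cvg_expr; rewrite ger0_norm.
exists (maxn n0 N); first exact: leq_maxl.
have := hN (maxn n0 N) (leq_maxr _ _); rewrite /= ger0_norm ?exprn_ge0//.
rewrite ltr_pdivlMr ?ltr_wpDl// => h; apply: le_lt_trans h.
by rewrite mulrC ler_wpM2l ?exprn_ge0// lerDl.
Qed.

Lemma eq0_of_geometric (X q K : R) n0 : 0 <= q < 1 -> 0 <= K ->
  (forall n, (n0 <= n)%N -> `|X| <= K * q ^+ n) -> X = 0.
Proof.
move=> hq K0 h; apply/eqP; apply: contraT; rewrite -normr_gt0 => X0.
have [n nn0] := geometric_small n0 hq K0 X0.
by rewrite ltNge h.
Qed.

(** Since [chi] vanishes on a neighbourhood, so does [chi']; hence products with [chi'] are also
    test functions off the product set. *)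
Lemma exists_cutoff_eps s C M : 0 < s -> ahlfors_regular s C ->
  exists2 K : R, 0 <= K & exists n0, forall n, (n0 <= n)%N ->
  exists (chi chi' : R -> R) (N : set R),
  [/\ [/\ smooth1 chi, smooth1 chi' & forall x, is_derive x 1 chi (chi' x)],
      measurable N /\ (leb N <= (K * eps n `^ (1 - s))%:E)%E,
      forall x, ~ N x -> chi x = 1 /\ chi' x = 0,
      forall x, `|1 - chi x| <= K /\ `|chi' x| <= K * 2 ^+ n &
      forall c, C c -> `|c| < M%:R ->
        (\forall x \near c, chi x = 0) /\ (\forall x \near c, chi' x = 0)].
Proof.
move=> s0 regC.
have [sigma [beta [beta' [tau [kappa [B [[sb sb' _] [hb _] [bE s_0 s_1] [b0 b'0 _ _] [B0 hB]]]]]]]] :=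
  @exists_kernel R.
have [K K0 [n0 hK]] := exists_cutoff sb sb' hb bE s_0 s_1 b0 b'0 B0
  (fun x => let: And3 h _ _ := hB x in h) (fun x => let: And3 _ h _ := hB x in h) M s0 regC.
exists K => //; exists n0 => n /hK [chi [chi' [N [h1 [mN hN] h2 h3 h4]]]].
exists chi, chi', N; split => //.
  suff -> : eps n `^ (1 - s) = (2 ^+ n) `^ s / 2 ^+ n by [].
  have e0 := eps_gt0 n; have es : eps n `^ s != 0 by rewrite gt_eqF// powR_gt0.
  rewrite powRD; last by rewrite (gt_eqF e0) implybT.
  rewrite powRr1 ?(ltW e0)// mulrC; congr (_ * _).
  by rewrite powRN; apply: (mulfI es); rewrite mulfV// powR_inv_mul ?exprn_gt0.
move=> c Cc cM; have chi0 := h4 c Cc cM; split => //.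
have [_ _ dchi] := h1.
apply: filterS (nbhs_interior chi0) => x hx.
have hn : \forall y \near x, cst 0 y = chi y by apply: filterS hx => y ->.
have d0 : is_derive x 1 chi 0 := near_eq_is_derive hn (is_derive_cst _ _ _).
by rewrite -(@derive_val _ _ _ _ _ _ _ (dchi x)) (@derive_val _ _ _ _ _ _ _ d0).
Qed.

(** As [chi] is [0] on [C] and [1] off [N], each bounded part of [C] lies in [N], whose measure
    tends to [0] because [s < 1]. *)
Lemma regular_null s C : 0 < s < 1 -> closed C -> ahlfors_regular s C -> leb C = 0%E.
Proof.
move=> /andP[s0 s1] cC regC.
have mC : measurable C := closed_measurable cC.
pose D M : set R := C `&` `]- M%:R, M%:R[%classic.
have mD M : measurable (D M) by apply: measurableI => //; exact: measurable_itv.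
apply: measure_negligible => //.
suff nD : leb.-negligible (\bigcup_M D M).
  apply: negligibleS nD => x Cx; exists (Num.bound `|x|) => //; split => //=.
  by rewrite in_itv /= -ltr_norml archi_boundP.
apply: negligible_bigcup => M.
suff L0 : leb (D M) = 0%E by exists (D M); split => //; exact: mD.
have [K K0 [n0 hK]] := exists_cutoff_eps M s0 regC.
have h n : (n0 <= n)%N -> (leb (D M) <= (K * (2^-1 `^ (1 - s)) ^+ n)%:E)%E.
  move=> /hK [chi [chi' [N [_ [mN hN] hc _ h0]]]].
  rewrite -eps_powR; apply: le_trans hN; apply: le_measure; [by apply: mem_set; exact: mD|by apply: mem_set|].
  move=> x [Cx /=]; rewrite in_itv /= -ltr_norml => xM.
  apply: contrapT => /hc [c1 _].
  have [/nbhs_singleton c0 _] := h0 x Cx xM.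
  by move/eqP: c1; rewrite c0 eq_sym oner_eq0.
have fD : leb (D M) \is a fin_num.
  by rewrite ge0_fin_numE// (le_lt_trans (h n0 (leqnn _)))// ltry.
rewrite -(fineK fD); congr (_%:E).
apply: (@eq0_of_geometric _ (2^-1 `^ (1 - s)) K n0) => //.
  by apply: half_powR_lt1; rewrite subr_gt0.
move=> n /h; rewrite -{1}(fineK fD) lee_fin.
by rewrite ger0_norm// fine_ge0.
Qed.

(** A ball inside [F] is connected, so it would put a second point into the component of its
    centre. *)
Lemma totally_disconnected_dense F (y e : R) : totally_disconnected F -> 0 < e ->
  exists2 y', ~ F y' & `|y - y'| < e.
Proof.
move=> tF e0; apply: contrapT => h.
have bF : ball y e `<=` F.
  by move=> z yz; apply: contrapT => Fz; apply: h; exists z.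
have Fy : F y by apply: bF; exact: ballxx.
have cb : connected (ball y e).
  rewrite ball_itv; apply/connected_intervalP; exact: interval_is_interval.
have /(_ (y + e / 2)) := connected_component_max (ballxx y e0) bF cb.
rewrite tF// => /(_ _) /= h2.
have : y + e / 2 = y.
  apply: h2; rewrite /ball /= opprD addrA subrr sub0r normrN ger0_norm ?divr_ge0 ?ltW//.
  by rewrite ltr_pdivrMr// ltr_pMr// ltr1n.
by move/eqP; rewrite -subr_eq0 addrAC subrr add0r mulf_eq0 invr_eq0 pnatr_eq0 orbF gt_eqF.
Qed.

End decay.

(** * Integration by parts across the product set *)

Section integration_by_parts.
Context {R : realType}.
Variables (s alpha : R) (C F : set R) (U G0 G1 : R * R -> R).
Local Notation leb := (@lebesgue_measure R).
Let Omega : set (R * R) := ~` (C `*` F).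

Hypotheses (s01 : 0 < s < 1) (regC : ahlfors_regular s C)
  (cF : closed F) (tdF : totally_disconnected F)
  (al0 : 0 < alpha) (al1 : 1 < (2 - s) * alpha)
  (bU : weight_bounded alpha U) (bG0 : weight_bounded alpha G0)
  (bG1 : weight_bounded alpha G1)
  (weak0 : forall w, test_function Omega w ->
    pairing U (partial ord0 w) = - pairing G0 w)
  (weak1 : forall w, test_function Omega w ->
    pairing U (partial ord_max w) = - pairing G1 w).

Variable phi : R * R -> R.
Hypothesis tphi : test_function setT phi.

Let one : R -> R := fun=> 1.
Let sone : smooth1 one. Proof. exact: smooth1_cst. Qed.
Let d0 := partial ord0 phi.
Let d1 := partial ord_max phi.
Let td0 : test_function setT d0. Proof. exact: test_function_partial. Qed.
Let td1 : test_function setT d1. Proof. exact: test_function_partial. Qed.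

Let in_window (M : nat) (psi : R * R -> R) :=
  forall z, psi z != 0 -> `|z.1| < M%:R /\ `|z.2| < M%:R.

Let in_window_le M N psi : (M <= N)%N -> in_window M psi -> in_window N psi.
Proof.
move=> MN h z /h [h1 h2]; have MN' : M%:R <= N%:R :> R by rewrite ler_nat.
by split; [exact: lt_le_trans h1 MN'|exact: lt_le_trans h2 MN'].
Qed.

Let common_window : exists M, [/\ in_window M phi, in_window M d0 & in_window M d1].
Proof.
have [M1 h1] := test_function_window tphi.
have [M2 h2] := test_function_window td0.
have [M3 h3] := test_function_window td1.
exists (M1 + M2 + M3)%N; split.
- by apply: in_window_le h1; rewrite -addnA leq_addr.
- by apply: in_window_le h2; rewrite -addnA addnCA leq_addr.
- by apply: in_window_le h3; rewrite leq_addl.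
Qed.

Let common_bound : exists2 B : R, 0 <= B &
  forall z, [/\ `|phi z| <= B, `|d0 z| <= B & `|d1 z| <= B].
Proof.
have [B1 B10 h1] := test_function_bounded tphi.
have [B2 B20 h2] := test_function_bounded td0.
have [B3 B30 h3] := test_function_bounded td1.
exists (B1 + B2 + B3) => [|z]; first by rewrite !addr_ge0.
split; first by rewrite (le_trans (h1 z))// -addrA lerDl addr_ge0.
  by rewrite (le_trans (h2 z))// addrAC lerDr addr_ge0.
by rewrite (le_trans (h3 z))// lerDr addr_ge0.
Qed.

Let test_cutoff M a b : in_window M phi -> smooth1 a -> smooth1 b ->
  (forall c, C c -> `|c| < M.+1%:R -> \forall x \near c, a x = 0) ->
  test_function Omega (tensor phi a b).
Proof.
move=> hM sa sb ha; apply: test_function_tensor => // z /contrapT [Cz Fz].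
have [zM|zM] := ltP `|z.1| M.+1%:R.
  have : \forall y \near z, a y.1 = 0 by apply: cvg_fst (ha _ Cz zM).
  by apply: filterS => y ->; rewrite mul0r mulr0.
(* The margin between [M] and [M.+1] makes [phi] vanish on a whole neighbourhood of [z]. *)
have {}zM : M%:R < `|z.1| by rewrite (lt_le_trans _ zM)// ltr_nat.
have : \forall y \near z, M%:R < `|y.1|.
  have hc : (fun y : R * R => `|y.1|) @ z --> `|z.1|.
    by apply: continuous_comp; [exact: cvg_fst|exact: norm_continuous].
  exact: (cvgr_gt _ hc _ zM).
apply: filterS => y yM.
have [->|/hM [yM' _]] := eqVneq (phi y) 0; first by rewrite mul0r.
by move: (lt_trans yM yM'); rewrite ltxx.
Qed.

Let test_off_F b : smooth1 b -> (forall y, F y -> \forall x \near y, b x = 0) ->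
  test_function Omega (tensor phi one b).
Proof.
move=> sb hb; apply: test_function_tensor => // z /contrapT [Cz Fz].
have : \forall y \near z, b y.2 = 0 by apply: cvg_snd (hb _ Fz).
by apply: filterS => y ->; rewrite !mulr0.
Qed.

Let partial0 (a a' b : R -> R) : (forall x : R, is_derive x 1 a (a' x)) -> smooth1 b ->
  partial ord0 (tensor phi a b) = fun z => tensor d0 a b z + tensor phi a' b z.
Proof. by case: tphi => sphi _ _ ha sb; exact: partial0_tensor. Qed.

Let partial1 (a b b' : R -> R) : smooth1 a -> (forall x : R, is_derive x 1 b (b' x)) ->
  partial ord_max (tensor phi a b) = fun z => tensor d1 a b z + tensor phi a b' z.
Proof. by case: tphi => sphi _ _ sa hb; exact: partial1_tensor. Qed.

Let pairing_split f psi a b : weight_bounded alpha f -> test_function setT psi ->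
  smooth1 a -> smooth1 b ->
  pairing f (tensor psi one b) =
    pairing f (tensor psi a b) + pairing f (tensor psi (fun x => 1 - a x) b).
Proof.
move=> bf tpsi sa sb; rewrite -(pairingD bf); last 2 first.
- exact: test_tensor.
- by apply: test_tensor => //; apply: smooth1B.
by congr pairing; apply/funext => z; rewrite /tensor /one; ring.
Qed.

Let tensor_one psi : tensor psi one one = psi.
Proof. by apply/funext => z; rewrite /tensor /one !mulr1. Qed.

Lemma weak_vertical : pairing U d1 = - pairing G1 phi.
Proof.
have /andP[s0 s1] := s01.
have [M [wphi _ wd1]] := common_window.
have [B B0 hB] := common_bound.
have [K K0 [n0 hK]] := exists_cutoff_eps M.+1 s0 regC.
have [KU KU0 hU] := tensor_bound bU al0.
have [KG KG0 hG] := tensor_bound bG1 al0.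
apply/eqP; rewrite -addr_eq0; apply/eqP.
(* [K * 1] bounds the weight [cochi * one], and [K * (2 * M%:R)] is the constant in the measure of
   [N] times [[-M, M]]. *)
pose c := B * (K * 1) * (KU + KG) * (K * (2 * M%:R)) `^ alpha.
apply: (@eq0_of_geometric _ _ (2^-1 `^ ((1 - s) * alpha)) c n0).
- by apply: half_powR_lt1; rewrite mulr_gt0// subr_gt0.
- by rewrite !mulr_ge0 ?powR_ge0// addr_ge0.
move=> n /hK [chi [chi' [N [[schi schi' dchi] [mN lN] hN bN hC]]]].
pose cochi x := 1 - chi x.
have scochi : smooth1 cochi by apply: smooth1B.
have tchi : test_function Omega (tensor phi chi one).
  by apply: (test_cutoff wphi) => // x Cx xM; have [] := hC x Cx xM.
have := weak1 tchi; rewrite (@partial1 _ _ (fun=> 0))//.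
rewrite [X in pairing U X](_ : _ = tensor d1 chi one); last first.
  by apply/funext => z; rewrite /tensor !mulr0 addr0.
move=> hw.
(* The [chi] parts cancel by the weak equation [hw]; only the [cochi] parts remain, supported over
   [N]. *)
rewrite -[in pairing U _](tensor_one d1) -[in pairing G1 _](tensor_one phi).
rewrite (pairing_split bU td1 schi sone) (pairing_split bG1 tphi schi sone) hw.
rewrite addrACA addNr add0r.
have MM : - M%:R <= M%:R :> R by rewrite (@le_trans _ _ 0)// oppr_le0.
pose I : set R := `[- M%:R, M%:R]%classic.
have mI : measurable I by exact: measurable_itv.
have lM : (leb I <= (2 * M%:R)%:E)%E.
  by rewrite /I itv_measure// lee_fin opprK mulr2n mulrDl mul1r.
have supp psi : in_window M psi -> forall z, ~ (N z.1 /\ I z.2) ->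
    tensor psi cochi one z = 0.
  move=> wpsi z hz; rewrite /tensor /cochi.
  have [Nz|/hN [-> _]] := pselect (N z.1); last by rewrite subrr mul0r mulr0.
  have [->|/wpsi [_ z2]] := eqVneq (psi z) 0; first by rewrite mul0r.
  by case: hz; split => //; rewrite /I /= in_itv /= -ler_norml ltW.
have bco x : `|cochi x| <= K by have [] := bN x.
have bone x : `|one x| <= 1 by rewrite normr1.
have hU1 := hU d1 cochi one N _ B K 1 _ _ td1 scochi sone mN mI lN lM
  (fun z => let: And3 _ _ h := hB z in h) bco bone (supp _ wd1).
have hG1 := hG phi cochi one N _ B K 1 _ _ tphi scochi sone mN mI lN lM
  (fun z => let: And3 h _ _ := hB z in h) bco bone (supp _ wphi).
apply: le_trans (ler_normD _ _) _; apply: (le_trans (lerD hU1 hG1)).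
have -> : (K * eps n `^ (1 - s) * (2 * M%:R)) `^ alpha =
    (K * (2 * M%:R)) `^ alpha * (2^-1 `^ ((1 - s) * alpha)) ^+ n.
  by rewrite mulrAC [LHS]powRM ?mulr_ge0 ?powR_ge0// -powRrM eps_powR.
rewrite /c le_eqVlt; apply/orP; left; apply/eqP; ring.
Qed.

(** The defect of the horizontal weak equation, read as a distribution in the second variable. *)
Let L b := pairing U (tensor d0 one b) + pairing G0 (tensor phi one b).
(** Halving the scale gains [2 ^ (- (2 - s) * alpha)] from the measure of the support and loses a
    factor [2] to the derivative. *)
Let q : R := 2^-1 `^ ((2 - s) * alpha - 1).

Let q01 : 0 <= q < 1. Proof. by apply: half_powR_lt1; rewrite subr_gt0. Qed.

(** [weak0] tested with [chi * Psi'] turns the [chi] part of [L Psi'] into minus the pairing of [U]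
    with [phi * chi' * Psi']. [weak1] tested with [chi' * Psi] then moves the derivative off [Psi],
    which leaves four pairings supported over [N] times [A]. *)
Lemma horizontal_key : exists2 K1 : R, 0 <= K1 & exists n0, forall n, (n0 <= n)%N ->
  forall (Psi Psi' : R -> R) (D : R) (A : set R),
  smooth1 Psi -> smooth1 Psi' -> (forall x : R, is_derive x 1 Psi (Psi' x)) ->
  (forall x, `|Psi x| <= D) -> (forall x, `|Psi' x| <= D * 2 ^+ n) ->
  measurable A -> (leb A <= (4 * eps n)%:E)%E ->
  (forall y, ~ A y -> Psi y = 0 /\ Psi' y = 0) ->
  `|L Psi'| <= K1 * D * q ^+ n.
Proof.
have /andP[s0 s1] := s01.
have [M [wphi _ _]] := common_window.
have [B B0 hB] := common_bound.
have [K K0 [n0 hK]] := exists_cutoff_eps M.+1 s0 regC.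
have [KU KU0 hU] := tensor_bound bU al0.
have [KG0 KG00 hG0] := tensor_bound bG0 al0.
have [KG1 KG10 hG1] := tensor_bound bG1 al0.
exists (B * K * (KU + KG0 + KU + KG1) * (4 * K) `^ alpha).
  by rewrite !mulr_ge0 ?powR_ge0// !addr_ge0.
exists n0 => n /hK [chi [chi' [N [[schi schi' dchi] [mN lN] hN bN hC]]]].
move=> Psi Psi' D A sP sP' dP bP bP' mA lA hA.
pose cochi x := 1 - chi x.
have scochi : smooth1 cochi by apply: smooth1B.
have t1 : test_function Omega (tensor phi chi Psi').
  by apply: (test_cutoff wphi) => // x Cx xM; have [] := hC x Cx xM.
have t2 : test_function Omega (tensor phi chi' Psi).
  by apply: (test_cutoff wphi) => // x Cx xM; have [] := hC x Cx xM.
have e1 := weak0 t1; rewrite (partial0 dchi sP') (pairingD bU) in e1; try exact: test_tensor.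
have e2 := weak1 t2; rewrite (partial1 schi' dP) (pairingD bU) in e2; try exact: test_tensor.
have LE : L Psi' = pairing U (tensor d0 cochi Psi') + pairing G0 (tensor phi cochi Psi')
   + pairing U (tensor d1 chi' Psi) + pairing G1 (tensor phi chi' Psi).
  rewrite /L (pairing_split bU td0 schi sP') (pairing_split bG0 tphi schi sP').
  move: e1 e2; rewrite -/cochi; lra.
have bco x : `|cochi x| <= K by have [] := bN x.
have bchi' x : `|chi' x| <= K * 2 ^+ n by have [] := bN x.
have supp1 psi : forall z, ~ (N z.1 /\ A z.2) -> tensor psi cochi Psi' z = 0.
  move=> z hz; rewrite /tensor /cochi.
  have [Nz|/hN [-> _]] := pselect (N z.1); last by rewrite subrr mul0r mulr0.
  have [Az|/hA [_ ->]] := pselect (A z.2); last by rewrite !mulr0.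
  by case: hz.
have supp2 psi : forall z, ~ (N z.1 /\ A z.2) -> tensor psi chi' Psi z = 0.
  move=> z hz; rewrite /tensor.
  have [Nz|/hN [_ ->]] := pselect (N z.1); last by rewrite mul0r mulr0.
  have [Az|/hA [-> _]] := pselect (A z.2); last by rewrite !mulr0.
  by case: hz.
have h1 := hU d0 cochi Psi' N A B K (D * 2 ^+ n) _ _ td0 scochi sP' mN mA lN lA
  (fun z => let: And3 _ h _ := hB z in h) bco bP' (supp1 _).
have h2 := hG0 phi cochi Psi' N A B K (D * 2 ^+ n) _ _ tphi scochi sP' mN mA lN lA
  (fun z => let: And3 h _ _ := hB z in h) bco bP' (supp1 _).
have h3 := hU d1 chi' Psi N A B (K * 2 ^+ n) D _ _ td1 schi' sP mN mA lN lA
  (fun z => let: And3 _ _ h := hB z in h) bchi' bP (supp2 _).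
have h4 := hG1 phi chi' Psi N A B (K * 2 ^+ n) D _ _ tphi schi' sP mN mA lN lA
  (fun z => let: And3 h _ _ := hB z in h) bchi' bP (supp2 _).
have e0 := @eps_gt0 R n.
(* The support has measure at most [4 * K * eps n] to the power [2 - s] in [eps n], and [2 ^+ n] is
   the inverse of [eps n]. *)
have qE : 2 ^+ n * (K * eps n `^ (1 - s) * (4 * eps n)) `^ alpha = (4 * K) `^ alpha * q ^+ n.
  rewrite /q -eps_powR (_ : K * _ * _ = (4 * K) * eps n `^ (2 - s)); last first.
    rewrite (_ : 2 - s = (1 - s) + 1); last by ring.
    rewrite [in RHS]powRD; last by rewrite (gt_eqF e0) implybT.
    by rewrite powRr1 ?(ltW e0)//; ring.
  rewrite [X in _ * X]powRM ?mulr_ge0 ?powR_ge0// -powRrM mulrCA; congr (_ * _).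
  rewrite powRD; last by rewrite (gt_eqF e0) implybT.
  by rewrite powRN powRr1 ?(ltW e0)// /eps invrK mulrC.
rewrite LE.
apply: le_trans (ler_normD _ _) _; apply: le_trans (lerD (ler_normD _ _) (lexx _)) _.
apply: le_trans (lerD (lerD (ler_normD _ _) (lexx _)) (lexx _)) _.
apply: le_trans (lerD (lerD (lerD h1 h2) h3) h4) _.
rewrite [leRHS](_ : _ = B * K * (KU + KG0 + KU + KG1) * D * ((4 * K) `^ alpha * q ^+ n)); last by ring.
rewrite -qE le_eqVlt; apply/orP; left; apply/eqP; ring.
Qed.

Let LD a b : smooth1 a -> smooth1 b -> L (fun x => a x + b x) = L a + L b.
Proof.
move=> sa sb.
have e psi : tensor psi one (fun x => a x + b x) =
    fun z => tensor psi one a z + tensor psi one b z.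
  by apply/funext => z; rewrite /tensor !mulrDr.
rewrite /L !e (pairingD bU (test_tensor td0 sone sa) (test_tensor td0 sone sb)).
by rewrite (pairingD bG0 (test_tensor tphi sone sa) (test_tensor tphi sone sb)) addrACA.
Qed.

Let LZ k b : smooth1 b -> L (fun x => k * b x) = k * L b.
Proof.
move=> sb.
have e psi : tensor psi one (fun x => k * b x) = fun z => k * tensor psi one b z.
  by apply/funext => z; rewrite /tensor; ring.
rewrite /L !e (pairingZ k bU (test_tensor td0 sone sb)).
by rewrite (pairingZ k bG0 (test_tensor tphi sone sb)) mulrDr.
Qed.

Let L_sum n (b : nat -> R -> R) : (forall j, smooth1 (b j)) ->
  L (fun x => \sum_(j < n) b j x) = \sum_(j < n) L (b j).
Proof.
move=> sb; elim: n => [|n IH].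
  transitivity (0 * L one); last by rewrite mul0r big_ord0.
  by rewrite -LZ//; congr L; apply/funext => x; rewrite big_ord0 mul0r.
rewrite big_ord_recr /= -IH -LD//; last exact: smooth1_sum.
by congr L; apply/funext => x; rewrite big_ord_recr.
Qed.

(** Such a [b] makes [phi * b] a test function off the product set, so [weak0] applies without a
    cutoff. *)
Let L_off_F b : smooth1 b -> (forall y, F y -> \forall x \near y, b x = 0) -> L b = 0.
Proof.
move=> sb hb; have := weak0 (test_off_F sb hb).
rewrite (@partial0 _ (fun=> 0))//.
rewrite [X in pairing U X](_ : _ = tensor d0 one b) => [e|].
  by rewrite /L e addNr.
by apply/funext => z; rewrite /tensor mul0r mulr0 addr0.
Qed.

(* Averages of the distribution [L] over intervals of length [eps n] decay like
   [q ^+ n]: consecutive scales and neighbouring centres differ by [O(q ^+ n)],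
   and the averages at a centre outside [F] are eventually zero. *)
Lemma weak_horizontal : pairing U d0 = - pairing G0 phi.
Proof.
have [sigma [beta [beta' [tau [kappa [B [[sb _ st] [_ dtau] [bE sg0 sg1]
  [b0 _ t0 t1] [B0 hB]]]]]]]] := @exists_kernel R.
have [K1 K10 [n0 key]] := horizontal_key.
have /andP[q0 q1] := q01.
pose P n : R := 2 ^+ n.
have P0 n : 0 < P n by rewrite exprn_gt0.
have PeE n : P n * eps n = 1 by rewrite mulfV// gt_eqF.
(* All kernels have the same mass [kappa], so a difference of two is the derivative of a compactly
   supported function, the difference of the [tker]. *)
pose kern n y0 y := P n * beta (P n * (y - y0)).
pose tker n y0 y := tau (P n * (y - y0)).
have aff n y0 (f : R -> R) :
    (fun y => f (P n * (y - y0))) = fun y => f (P n * y + - (P n * y0)).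
  by apply/funext => y; rewrite mulrBr.
have sk n y0 : smooth1 (kern n y0).
  by apply: smooth1M; [exact: smooth1_cst|rewrite aff; exact: smooth1_affine].
have stk n y0 : smooth1 (tker n y0) by rewrite /tker aff; exact: smooth1_affine.
have dk n y0 (y : R) : is_derive y 1 (tker n y0) (kern n y0 y).
  rewrite /tker aff /kern mulrBr; exact: is_derive1_affine.
pose m n y0 := L (kern n y0).
pose K2 := K1 * (3 * B).
have K20 : 0 <= K2 by rewrite !mulr_ge0.
have compare n n' y0 y1 : (n0 <= n)%N -> (n <= n' <= n.+1)%N -> `|y0 - y1| <= eps n ->
    `|m n y0 - m n' y1| <= K2 * q ^+ n.
  move=> nn0 /andP[n1 n2] yy.
  have -> : m n y0 - m n' y1 = L (fun x => kern n y0 x - kern n' y1 x).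
    rewrite /m -mulN1r -LZ// -LD//; last by apply: smooth1M => //; exact: smooth1_cst.
    by congr L; apply/funext => x; rewrite mulN1r.
  have PP : P n <= P n' by rewrite ler_eXn2l// ltr1n.
  have PP2 : P n' <= 2 * P n by rewrite -exprS ler_eXn2l// ltr1n.
  have e0 := @eps_gt0 R n.
  have big k x : P n <= P k -> eps n <= x -> 1 <= P k * x.
    move=> Pk ex; rewrite -(PeE n); apply: ler_pM => //; exact: ltW.
  have out y : y \notin `[y0 - 2 * eps n, y0 + 2 * eps n] ->
      (P n * (y - y0) <= -1 /\ P n' * (y - y1) <= -1) \/
      (1 <= P n * (y - y0) /\ 1 <= P n' * (y - y1)).
    move: yy; rewrite in_itv /= negb_and -!ltNge ler_norml => /andP[yy1 yy2] /orP[yl|yr].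
      left; split; rewrite -[_ * _]opprK -mulrN lerN2 big//; lra.
    right; split; rewrite big//; lra.
  (* Off an interval of length [4 * eps n] both antiderivatives are [0] (on the left) or [kappa] (on
     the right). The bound [3 * B] covers [B + B] for their difference and, as [P n' <= 2 * P n],
     also [B + 2 * B] for its derivative. *)
  apply: (key n nn0 (fun x => tker n y0 x - tker n' y1 x) _ (3 * B)
            `[y0 - 2 * eps n, y0 + 2 * eps n]%classic).
  - exact: smooth1B.
  - exact: smooth1B.
  - move=> x; apply: le_trans (ler_normB _ _) _.
    have [_ _ h1] := hB (P n * (x - y0)); have [_ _ h2] := hB (P n' * (x - y1)).
    by apply: le_trans (lerD h1 h2) _; lra.
  - move=> x; apply: le_trans (ler_normB _ _) _.
    have [h1 _ _] := hB (P n * (x - y0)); have [h2 _ _] := hB (P n' * (x - y1)).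
    rewrite /kern !normrM !(gtr0_norm (P0 _)) -/(P n).
    have h3 : P n' * `|beta (P n' * (x - y1))| <= 2 * P n * B.
      by apply: ler_pM => //; exact: ltW.
    have h4 : P n * `|beta (P n * (x - y0))| <= P n * B by rewrite ler_pM2l.
    by apply: le_trans (lerD h4 h3) _; rewrite le_eqVlt; apply/orP; left; apply/eqP; ring.
  - exact: measurable_itv.
  - rewrite itv_measure; last by rewrite lerD2l; lra.
    by rewrite lee_fin; lra.
  move=> y /negP /out; rewrite /tker /kern => -[[h1 h2]|[h1 h2]].
    by rewrite !t0// !b0 ?mulr0 ?subrr// ler_normr; apply/orP; right; lra.
  by rewrite !t1// !b0 ?mulr0 ?subrr// ler_normr ?h1 ?h2.
(* At fine scales the kernel centred at [y1] is supported away from the closed set [F]. *)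
have zero y1 : ~ F y1 -> exists N, forall k, (N <= k)%N -> m k y1 = 0.
  move=> Fy1.
  have /nbhs_ballP [e /= e0 he] : nbhs y1 (~` F).
    exact: open_nbhs_nbhs (conj (closed_openC cF) Fy1).
  have hq : 0 <= (2^-1 : R) < 1 by rewrite invr_ge0 invf_lt1 ?ltr1n// ler0n.
  have [N _] := geometric_small 0 hq ler01 e0; rewrite mul1r exprVn -/(eps N) => hN.
  exists N => k Nk; apply: L_off_F => // y Fy.
  have ke : eps k < `|y - y1|.
    apply: le_lt_trans (_ : eps N < _).
      by rewrite lef_pV2 ?posrE ?exprn_gt0// ler_eXn2l// ltr1n.
    apply: lt_le_trans hN _; rewrite leNgt; apply/negP => yy.
    by apply: (he y) => //; rewrite /ball /= distrC.
  have hc : (fun x : R => `|x - y1|) @ y --> `|y - y1|.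
    by apply: cvg_norm; apply: cvgB; [exact: cvg_id|exact: cvg_cst].
  apply: filterS (cvgr_gt _ hc _ ke) => x hx.
  rewrite /kern b0 ?mulr0// normrM (gtr0_norm (P0 k)) -(PeE k).
  by rewrite ler_pM2l// ltW.
(* [K2 / (1 - q) * q ^+ n] is the sum of the one-step errors [K2 * q ^+ k] over all [k >= n]. *)
have tele k n y1 : (n0 <= n)%N -> `|m n y1| <= K2 / (1 - q) * q ^+ n + `|m (n + k)%N y1|.
  elim: k n => [|k IH] n nn0.
    by rewrite addn0 lerDr !mulr_ge0 ?invr_ge0 ?subr_ge0 ?exprn_ge0// ltW.
  have h1 := IH n.+1 (leqW nn0); rewrite addSnnS in h1.
  have /= h2 := @compare n n.+1 y1 y1 nn0; rewrite leqnSn leqnn subrr normr0 in h2.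
  have {}h2 := h2 isT (ltW (eps_gt0 n)).
  have := ler_normD (m n y1 - m n.+1 y1) (m n.+1 y1); rewrite subrK => h3.
  have -> : K2 / (1 - q) * q ^+ n = K2 * q ^+ n + K2 / (1 - q) * q ^+ n.+1.
    by rewrite exprS; field; rewrite subr_eq0 gt_eqF.
  by apply: (le_trans h3); rewrite -[leRHS]addrA; exact: lerD h2 h1.
pose K3 := K2 + K2 / (1 - q).
have K30 : 0 <= K3 by rewrite addr_ge0// divr_ge0// subr_ge0 ltW.
(* Shift to a centre off [F] within [eps n], at cost [K2 * q ^+ n], then telescope to a scale where
   the average vanishes. *)
have decay n y0 : (n0 <= n)%N -> `|m n y0| <= K3 * q ^+ n.
  move=> nn0.
  have [y1 Fy1 yy] := totally_disconnected_dense y0 tdF (eps_gt0 n).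
  have [N hN] := zero y1 Fy1.
  have h1 := tele N n y1 nn0; rewrite (hN (n + N)%N (leq_addl _ _)) normr0 addr0 in h1.
  have h2 := compare n n y0 y1 nn0; rewrite leqnn leqnSn in h2.
  have {}h2 := h2 isT (ltW yy).
  have := ler_normD (m n y0 - m n y1) (m n y1); rewrite subrK => h3.
  by apply: (le_trans h3); rewrite mulrDl lerD.
have [M [wphi wd0 _]] := common_window.
(* The bumps sum to [1] on the window that contains the supports of [phi] and [d0]. *)
have part n : L one = \sum_(j < (2 * M * 2 ^ n).+1) L (bump_at beta M n j).
  rewrite -(@L_sum _ (fun j => bump_at beta M n j)); last by move=> j; exact: smooth1_bump.
  have e psi : in_window M psi -> tensor psi one one =
      tensor psi one (fun x => \sum_(j < (2 * M * 2 ^ n).+1) bump_at beta M n j x).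
    move=> wpsi; apply/funext => z; rewrite /tensor.
    have [->|/wpsi [_ z2]] := eqVneq (psi z) 0; first by rewrite !mul0r.
    by rewrite (sum_bump bE sg0 sg1 n (ltW z2)).
  by rewrite /L (e d0)// (e phi).
have bumpE n j : L (bump_at beta M n j) = eps n * m n (grid M n j).
  rewrite /m -LZ//; congr L; apply/funext => y.
  by rewrite /bump_at /kern mulrA [eps n * _]mulrC PeE mul1r bump_grid.
(* There are [2 * M * 2 ^ n + 1] bumps, each contributing at most [eps n * K3 * q ^+ n]; since
   [eps n <= 1] the total is at most [(2 * M + 1) * K3 * q ^+ n]. *)
have L1 : L one = 0.
  apply: (@eq0_of_geometric _ _ q ((2 * M%:R + 1) * K3) n0) => //.
    by rewrite mulr_ge0// addr_ge0 // mulr_ge0.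
  move=> n nn0; rewrite (part n).
  apply: le_trans (ler_norm_sum _ _ _) _.
  apply: le_trans (_ : \sum_(j < (2 * M * 2 ^ n).+1) eps n * (K3 * q ^+ n) <= _).
    apply: ler_sum => j _; rewrite bumpE normrM (gtr0_norm (eps_gt0 n)).
    by rewrite ler_pM2l ?eps_gt0// decay.
  rewrite sumr_const card_ord -[_ *+ (2 * M * 2 ^ n).+1]mulr_natr -(natr1 (2 * M * 2 ^ n)) natrM natrX natrM -/(P n).
  rewrite mulrAC -[leRHS]mulrA ler_wpM2r ?mulr_ge0 ?exprn_ge0//.
  rewrite (_ : eps n * _ = 2 * M%:R * (P n * eps n) + eps n); last by ring.
  rewrite PeE mulr1 lerD2l.
  by rewrite /eps invf_le1 ?exprn_ege1 ?ler1n// exprn_gt0.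
by apply/eqP; rewrite -addr_eq0 -(tensor_one d0) -[in pairing G0 _](tensor_one phi); apply/eqP.
Qed.

End integration_by_parts.

(** * Removability *)

#[local] Instance ae_plane_filter (R : realType) :
  Filter (almost_everywhere (@lebesgue_measure2 R)).
Proof. exact: ae_filter_ringOfSetsType. Qed.

Section null_complement.
Context {R : realType}.
Local Notation mR := (measurableTypeR R).
Local Notation mu2 := (@lebesgue_measure2 R).
Variable E : set (R * R).
Hypotheses (mE : measurable (E : set (mR * mR))) (E0 : mu2 E = 0%E).

Let mEC : measurable (~` E : set (mR * mR)). Proof. exact: measurableC. Qed.

Lemma ae_notin_null : {ae mu2, forall z, ~ E z}.
Proof. by exists E; split => // z /=; exact: contrapT. Qed.

Lemma restrict_ae_eq (f : R * R -> R) :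
  {ae mu2, forall z, (f \_ (~` E)) z = f z}.
Proof.
apply: filterS ae_notin_null => z Ez.
by rewrite patchE mem_set.
Qed.

Lemma measurable_restrict_null (f : R * R -> R) :
  measurable_fun setT (f : mR * mR -> R) ->
  measurable_fun setT (f \_ (~` E) : mR * mR -> R).
Proof.
by move=> mf; apply: (measurable_restrictT _ mEC).1; exact: measurable_funTS.
Qed.

Lemma Lfun_restrict_null (p : \bar R) (f : R * R -> R) :
  f \in Lfun mu2 p -> f \_ (~` E) \in Lfun mu2 p.
Proof.
move=> /andP[/[!inE]/= mf ff]; apply/andP; rewrite !inE /=.
have mf' := measurable_restrict_null mf.
split => //; move: ff; rewrite /finite_norm; congr (_ < _)%E.
have h := restrict_ae_eq f.
rewrite unlock; case: p => [r||] /=.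
- have mp g : measurable_fun setT (g : mR * mR -> R) ->
      measurable_fun setT (fun z : mR * mR => `|(g z)%:E| `^ r)%E.
    move=> mg; change (measurable_fun setT (EFin \o (fun z : mR * mR => `|g z| `^ r))).
    apply/measurable_EFinP; apply: (@measurableT_comp _ _ _ _ _ _ (@powR R ^~ r)) => //.
    exact: measurableT_comp.
  have -> : (\int[mu2]_x `|(f x)%:E| `^ r = \int[mu2]_x `|((f \_ (~` E)) x)%:E| `^ r)%E.
    apply: ae_eq_integral; [exact: measurableT|exact: mp|exact: mp|].
    by apply: filterS h => z /= -> _.
  by [].
- case: ifP => // _; apply: eq_ess_sup.
  by apply: filterS h => z /= ->.
- case: ifP => // _; apply: eq_ess_inf.
  by apply: filterS h => z /= ->.
Qed.

Lemma Rintegral_null_complement (f : R * R -> R) :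
  measurable_fun setT (f : mR * mR -> R) ->
  \int[mu2]_(z in ~` E) f z = \int[mu2]_(z in setT) f z.
Proof.
move=> mf; rewrite Rintegral_mkcond /Rintegral; congr fine.
apply: ae_eq_integral => //.
- by apply/measurable_EFinP; exact: measurable_restrict_null.
- exact/measurable_EFinP.
by apply: filterS (restrict_ae_eq f) => z /= -> _.
Qed.

Lemma pairing_restrict (D : set (R * R)) (f w : R * R -> R) :
  \int[mu2]_(z in D) (f z * w z) = pairing (f \_ D) w.
Proof.
rewrite Rintegral_mkcond; apply: eq_Rintegral => z _.
by rewrite !patchE; case: ifP => // _; rewrite mul0r.
Qed.

End null_complement.

Lemma closed_setX2 (R : realType) (C F : set R) : closed C -> closed F ->
  closed (C `*` F : set (R * R)).
Proof.
move=> cC cF; have -> : C `*` F = (fst @^-1` C) `&` (snd @^-1` F) by [].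
apply: closedI; apply: closed_comp => // z _; [exact: cvg_fst|exact: cvg_snd].
Qed.

Theorem theorem4p1 (R : realType) (s : R) (C F : set R) :
  0 < s < 1 ->
  closed C -> ahlfors_regular s C ->
  closed F -> totally_disconnected F ->
  forall p : \bar R, (((2 - s) / (1 - s))%:E < p)%E -> removable p (C `*` F).
Proof.
move=> s01 cC regC cF tdF p hp.
have cE := closed_setX2 cC cF.
have E0 : lebesgue_measure2 (C `*` F) = 0%E.
  by rewrite lebesgue_measure2X ?(regular_null s01 cC regC) ?mul0e//; exact: closed_measurable.
have mE : measurable (C `*` F : set (measurableTypeR R * measurableTypeR R)).
  by apply: measurableX; exact: closed_measurable.
have [alpha [al0 al1 hLfun]] := Lfun_weighted_le s01 hp.
have bounded f : f \in Lfun (@lebesgue_measure2 R) p -> weight_bounded alpha f by exact: hLfun.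
split => //; apply/seteqP; split => u [v [uv vp hg]].
- set Omega := ~` (C `*` F) in uv vp hg.
  have [g0 g0p w0] := hg ord0; have [g1 g1p w1] := hg ord_max.
  have weak g i : weak_partial Omega i v g -> forall w, test_function Omega w ->
      pairing (v \_ Omega) (partial i w) = - pairing (g \_ Omega) w.
    by move=> h w tw; rewrite -!pairing_restrict; exact: h.
  (* Extension by zero across the null product set, for the function here and for its weak
     derivatives below. *)
  exists (v \_ Omega); split.
  + have hE := ae_notin_null mE E0.
    apply: filterS2 uv hE => z h Ez _; rewrite patchE mem_set//; exact: h.
  + by rewrite patch_setT.
  have i2 (i : 'I_2) : i = ord0 \/ i = ord_max.
    by case: i => [[|[|//]] h]; [left|right]; exact/val_inj.
  move=> i; have [->|->] := i2 i.
    exists (g0 \_ Omega); first by rewrite patch_setT.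
    move=> phi tphi; exact: (weak_horizontal s01 regC cF tdF al0 al1
      (bounded _ vp) (bounded _ g0p) (bounded _ g1p) (weak _ _ w0) (weak _ _ w1) tphi).
  exists (g1 \_ Omega); first by rewrite patch_setT.
  move=> phi tphi; exact: (weak_vertical s01 regC al0 (bounded _ vp) (bounded _ g1p)
      (weak _ _ w1) tphi).
- rewrite patch_setT in vp; exists v; split.
  + by apply: filterS uv => z h _; exact: h.
  + exact: Lfun_restrict_null.
  move=> i; have [g gp wg] := hg i; rewrite patch_setT in gp.
  exists g; first exact: Lfun_restrict_null.
  have mv : measurable_fun setT v by move: vp => /andP[/[!inE]].
  have mg : measurable_fun setT g by move: gp => /andP[/[!inE]].
  (* A test function off the product set is also one on the plane, and the integrals do not see the
     null set. *)
  move=> phi tphi; have tphi' := test_function_setT tphi.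
  rewrite !Rintegral_null_complement//; first exact: wg.
  + apply: measurable_funM => //; exact: test_function_measurable.
  apply: measurable_funM => //; apply: test_function_measurable.
  exact: test_function_partial.
Qed.
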